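(* For $\theta\in(0,1]$ and $x\in\mathbb{R}$ define \[Q_\theta(x)=\sum_{j=0}^{\lfloor 1/\theta\rfloor+1}\frac{(-x)^j}{j!}\bigl(1-(j-1)\theta\bigr)^j,\] and let $m_c(\theta)$ be the minimal root of the polynomial equation $Q_\theta(m)=0$. Suppose that $T$ is a Bienaymé–Galton–Watson tree whose offspring distribution $L$ satisfies $\mathbb{E}[L]=m$ and $\mathbb{E}[L\log_+L]<\infty$. Then there is Rough Mount Fuji accessibility percolation (with parameter $\theta$) with positive probability on $T$ if and only if $m>m_c(\theta)$.
   Context: Rough Mount Fuji (RMF) labels: given a locally finite rooted tree with vertex set $V$, root $\rho$ and graph distance $d$, and $\theta\in[0,1]$, let $\{U_v:v\in V\}$ be i.i.d. Uniform$(0,1)$ random variables and set $X_v=U_v+\theta\, d(\rho,v)$. For a random tree, the $U_v$ are independent of the tree. A simple path $\rho=v_0,v_1,v_2,\ldots$ started from the root is called increasing (accessible) if $X_{v_0}<X_{v_1}<X_{v_2}<\cdots$. RMF accessibility percolation is the event that there exists an infinite increasing path started from $\rho$. A Bienaymé–Galton–Watson tree with offspring distribution $L$ (a random variable with values in $\{0,1,2,\ldots\}$) is the random rooted tree in which each vertex independently has a number of children distributed as $L$. Here $\log_+x=\max(\log x,0)$ (with $0\log_+0=0$). The probability is over both the tree and the labels.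
   Formalization: The single case θ=1 with L=1 almost surely is excluded: there m=m_c(1)=1, yet T is an infinite ray along which labels increase almost surely, so percolation has probability 1 and the equivalence fails. *)

(* Defs.v *)
From HB Require Import structures.
From mathcomp Require Export all_boot all_order all_algebra finmap.
From mathcomp Require Export all_classical all_reals all_analysis.

Set Implicit Arguments.
Unset Strict Implicit.
Unset Printing Implicit Defensive.

Import Order.TTheory GRing.Theory Num.Theory.
Local Open Scope classical_set_scope.
Local Open Scope ring_scope.

(* Here j%:R - 1 is a subtraction in R, so the factor for j = 0 is
   1 + theta (raised to the power 0). *)
Definition Qtheta (R : realType) (theta x : R) : R :=
  \sum_(0 <= j < (Num.truncn theta^-1 + 1).+1)
    (- x) ^+ j / j`!%:R * (1 - (j%:R - 1) * theta) ^+ j.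

Definition minimal_root (R : realType) (f : R -> R) (r : R) : Prop :=
  f r = 0 /\ forall x, f x = 0 -> r <= x.

(* Ulam-Harris encoding: vertices are words of natural numbers, the root is
   [::], and the children of v are the words rcons v i with i smaller than the
   number N v of children of v. *)
Definition gw_tree (N : seq nat -> nat) : set (seq nat) :=
  [set v | forall u i, prefix (rcons u i) v -> (i < N u)%N].

Definition adjacent (u v : seq nat) : Prop :=
  exists i, v = rcons u i \/ u = rcons v i.

(* In Ulam-Harris encoding the graph distance from the root to v is the length
   of the word v. *)
Definition rmf_label (R : realType) (theta : R) (U : seq nat -> R)
  (v : seq nat) : R := U v + theta * (size v)%:R.

Definition percolates (R : realType) (T : set (seq nat)) (X : seq nat -> R) :
  Prop :=
  exists v : nat -> seq nat,
    [/\ v 0%N = [::],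
        forall n, T (v n),
        forall n, adjacent (v n) (v n.+1),
        injective v &
        forall n, X (v n) < X (v n.+1)].

Definition mutually_independent d (Omega : measurableType d) (R : realType)
    (P : probability Omega R) (I : choiceType) (F : I -> set (set Omega)) :
  Prop :=
  forall (J : {fset I}) (A : I -> set Omega),
    (forall i, i \in J -> F i (A i)) ->
    P (\bigcap_(i in [set` J]) A i) = (\prod_(i <- J) P (A i))%E.

Definition generated_sigma d d' (Omega : measurableType d)
    (T : measurableType d') (X : Omega -> T) : set (set Omega) :=
  preimage_set_system setT X measurable.

Definition has_law d d' (Omega : measurableType d) (T : measurableType d')
    (R : realType) (P : probability Omega R) (X : {RV P >-> T})
    (mu : set T -> \bar R) : Prop :=
  forall A, measurable A -> distribution P X A = mu A.

(* Offspring numbers N and uniform variables U are attached to all words, not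
   only to those that turn out to be vertices of the random tree; joint mutual
   independence makes U independent of the tree. *)
Record gw_rmf d (Omega : measurableType d) (R : realType)
    (P : probability Omega R) (L : probability nat R)
    (N : seq nat -> {RV P >-> nat}) (U : seq nat -> {RV P >-> R}) : Prop :=
  GwRmf {
    gw_rmf_offspring : forall v, has_law (N v) L ;
    gw_rmf_uniform : forall v, has_law (U v) (uniform_prob (@ltr01 R)) ;
    gw_rmf_independent :
      mutually_independent P (fun i : seq nat + seq nat =>
        match i with
        | inl v => generated_sigma (N v)
        | inr v => generated_sigma (U v)
        end) }.

Definition rmf_percolation d (Omega : measurableType d) (R : realType)
    (P : probability Omega R) (theta : R) (N : seq nat -> {RV P >-> nat})
    (U : seq nat -> {RV P >-> R}) : set Omega :=
  [set w | percolates (gw_tree (fun v => N v w))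
                      (rmf_label theta (fun v => U v w))].

(* ln 0 = 0 in the library, which gives the convention 0 * log_+ 0 = 0. *)
Definition logp (R : realType) (x : R) : R := Num.max (ln x) 0.

(* Main.v *)
Require Import Defs.
From mathcomp Require Import all_boot all_order all_algebra finmap.
From mathcomp Require Import all_classical all_reals all_analysis.
From mathcomp Require Import ring lra.

(** Call a vertex [v] with label [U v = x] good to depth [n] when an increasing
path of length [n] starts downwards from it.  Subtracting the drift, a child
[w] of [v] may follow [v] on such a path exactly when [U w > x - theta], so the
increasing paths form a branching process with types in [0,1] and mean operator
[m K], where [K f x] is the integral of [f] over the part of [0,1] above
[x - theta].  The theorem says that survival is decided by comparing [m] with
the inverse [mc] of the spectral radius of [K].

A positive eigenfunction [phi = mc K phi] is constant on [0,theta] and solves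
the delay equation [phi' x = - mc * phi (x - theta)] beyond; extending it by
that equation to [0,1+theta], the eigenvalue condition becomes
[phi (1 + theta) = 0].  Solving the delay equation step by step from the
constant 1 gives the explicit sum [delay_fun], whose value at [1 + theta] is
[Qtheta theta mc].  That the smallest root [mc] of [Qtheta theta] is the right
one, that is, that its solution is nonnegative up to [1 + theta], is obtained by
taking the smallest parameter at which the solution fails to be positive
somewhere on [0,1+theta]: by compactness it exists, and there the solution is
nonnegative, hence nonincreasing, hence its zero propagates to the right end
([exists_critical], [exists_eigenfunction]).  The equation is only ever used in
its integrated form, bounding increments of [phi (_ + theta)].

On the probabilistic side, let [G p] be the probability that some child is hit
when children are hit independently with probability [p] ([mean_hit_prob]).
Disjoint subtrees carry independent randomness ([block_independent]), so the
probability that a vertex with label [x] is good to depth [n + 1] is at most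
(at least) [G p] as soon as [p] bounds from above (below) the probability that a
given child is above [x - theta] and good to depth [n]
([pr_reach_le], [pr_reach_ge]); and the latter is bounded by
[c * phi x / mc] if the former at depth [n] is bounded by [c * phi]
([pr_above_le], [pr_above_ge]).

If [mc < m], then [mc * p <= G p] for small [p] because [G] has slope [m] at 0,
and a small multiple of [phi] stays below all the probabilities.  If [m <= mc],
then [G p < mc * p] for [p > 0], and since [G p / p] is nonincreasing, the
multiple of [phi] that stays above can be lowered at each step by a factor
that is read off at the point 1, where [phi] is smallest; the multiples tend
to 0 ([extinction_seq_small]).  At criticality the strict inequality comes from
a positive probability of having two children or more: otherwise [m <= 1],
while [1 <= mc] with equality only for [theta = 1], so that equality throughout
is the excluded degenerate case.  Finally, the tree is locally finite, so
percolation is the decreasing intersection over [n] of the events that the root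
is good to depth [n] ([percolation_bigcap]). *)

Set Implicit Arguments.
Unset Strict Implicit.
Unset Printing Implicit Defensive.

Import Order.TTheory GRing.Theory Num.Theory.
Import numFieldNormedType.Exports.
Local Open Scope classical_set_scope.
Local Open Scope ring_scope.

(** * Increments without integrals, and the delay equation *)

(** On a grid of mesh [(b - a) / n] the increments of [D] add up to at most
[(b - a) / n * (v b - v a)], which tends to 0.  Used with [v] the modulus by
which a Riemann sum misses, this replaces every integral below. *)
Lemma le_of_telescoping (R : realType) (D v : R -> R) (a b : R) :
  a <= b ->
  (forall x y, a <= x -> x <= y -> y <= b ->
     D y - D x <= (y - x) * (v y - v x)) ->
  D b <= D a.
Proof.
move=> ab incD.
have step n : (D b - D a) * n.+1%:R <= (b - a) * (v b - v a).
  pose t k := a + (b - a) * (k%:R / n.+1%:R).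
  have tS k : t k.+1 - t k = (b - a) / n.+1%:R.
    by rewrite /t -natr1; field.
  have t0 : t 0%N = a by rewrite /t mul0r mulr0 addr0.
  have tn : t n.+1 = b by rewrite /t divff ?pnatr_eq0//; ring.
  have ba0 : 0 <= b - a by rewrite subr_ge0.
  have tge k : a <= t k by rewrite /t lerDl mulr_ge0 // divr_ge0.
  have tle k : (k <= n.+1)%N -> t k <= b.
    move=> kn; rewrite -tn /t lerD2l ler_wpM2l// ler_pM2r ?invr_gt0 ?ltr0n//.
    by rewrite ler_nat.
  have main k : (k <= n.+1)%N ->
      D (t k) - D a <= (b - a) / n.+1%:R * (v (t k) - v a).
    elim: k => [|k IH] kn; first by rewrite t0 !subrr mulr0.
    have tt : t k <= t k.+1 by rewrite -subr_ge0 tS divr_ge0.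
    have := incD _ _ (tge k) tt (tle _ kn).
    by rewrite tS; move: (IH (ltnW kn)); set c := _ / _; lra.
  have := main n.+1 (leqnn _); rewrite tn.
  by rewrite -ler_pdivlMr ?ltr0n// mulrAC.
rewrite leNgt; apply/negP => Dab.
have D0 : 0 < D b - D a by rewrite subr_gt0.
have [n] : exists n, (b - a) * (v b - v a) / (D b - D a) < n.+1%:R.
  by exists (Num.truncn ((b - a) * (v b - v a) / (D b - D a))); exact: truncnS_gt.
by rewrite ltr_pdivrMr// [X in _ < X]mulrC ltNge step.
Qed.

Definition pos_part (R : realType) (x : R) : R := Num.max x 0.

Section pos_part.
Context {R : realType}.
Implicit Types x y : R.

Lemma pos_part_ge0 x : 0 <= pos_part x.
Proof. by rewrite le_max lexx orbT. Qed.

Lemma pos_part_id x : 0 <= x -> pos_part x = x.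
Proof. by move=> x0; exact/max_idPl. Qed.

Lemma pos_part_eq0 x : x <= 0 -> pos_part x = 0.
Proof. by move=> x0; exact/max_idPr. Qed.

Lemma pos_part_lip x y : x <= y -> pos_part y - pos_part x <= y - x.
Proof.
move=> xy; rewrite /pos_part; case: (leP x 0) => x0; case: (leP y 0) => y0; lra.
Qed.

(** The mean value bounds for the power function, from the factorization of
[b ^+ n.+1 - a ^+ n.+1] into [b - a] and a sum of [n.+1] monomials. *)
Lemma exprS_sub_bounds (a b : R) n : 0 <= a -> a <= b ->
  n.+1%:R * a ^+ n * (b - a) <= b ^+ n.+1 - a ^+ n.+1 <=
  n.+1%:R * b ^+ n * (b - a).
Proof.
move=> a0 ab; have b0 := le_trans a0 ab.
have ba0 : 0 <= b - a by rewrite subr_ge0.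
rewrite subrXX [(b - a) * _]mulrC; apply/andP; split; apply: ler_wpM2r => //.
- have -> : n.+1%:R * a ^+ n = \sum_(i < n.+1) a ^+ n.
    by rewrite sumr_const card_ord mulr_natl.
  apply: ler_sum => i _; rewrite -{1}[n](@subnK i)// -1?ltnS//.
  rewrite exprD ler_wpM2r ?exprn_ge0//.
  by rewrite lerXn2r.
- have -> : n.+1%:R * b ^+ n = \sum_(i < n.+1) b ^+ n.
    by rewrite sumr_const card_ord mulr_natl.
  apply: ler_sum => i _; rewrite -[X in _ <= b ^+ X](@subnK i)// -1?ltnS//.
  rewrite exprD ler_wpM2l ?exprn_ge0//.
  by rewrite lerXn2r.
Qed.

(** The function [pos_part _ ^+ j.+2] is a primitive of
[j.+2%:R * pos_part _ ^+ j.+1], and the latter is monotone, so a one-point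
Riemann sum errs by at most the length times the variation.  The exponent
starts at 2 because [pos_part _ ^+ 0] is not the derivative of [pos_part] at
negative arguments. *)
Lemma pos_part_prim_increment x y j : x <= y ->
  `|pos_part y ^+ j.+2 - pos_part x ^+ j.+2
    - (y - x) * (j.+2%:R * pos_part x ^+ j.+1)| <=
  (y - x) * (j.+2%:R * (pos_part y ^+ j.+1 - pos_part x ^+ j.+1)).
Proof.
move=> xy; have [x0|x0] := leP 0 x.
  have y0 := le_trans x0 xy.
  rewrite !pos_part_id//.
  have /andP[lo hi] := @exprS_sub_bounds x y j.+1 x0 xy.
  rewrite ger0_norm; lra.
rewrite (pos_part_eq0 (ltW x0)) !expr0n/= !mulr0 !subr0.
rewrite ger0_norm ?exprn_ge0 ?pos_part_ge0//.
rewrite exprS mulrA ler_wpM2r ?exprn_ge0 ?pos_part_ge0//.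
have yx : pos_part y <= y - x.
  by have := pos_part_lip xy; rewrite (pos_part_eq0 (ltW x0)) subr0.
apply: (le_trans yx); rewrite ler_peMr ?subr_ge0//.
by rewrite ler1n.
Qed.

End pos_part.

Section delay_function.
Context {R : realType}.
Implicit Types (n : nat) (theta m x y : R).

(** The solution of [f' x = - m * f (x - theta)] with [f = 1] on [0,theta],
obtained by the method of steps; [n] terms suffice for [x <= n%:R * theta]. *)
Definition delay_fun n theta m x : R :=
  \sum_(0 <= j < n) (- m) ^+ j / j`!%:R * pos_part (x - j%:R * theta) ^+ j.

(** A primitive of [delay_fun] on the nonnegative half-line, vanishing at 0. *)
Definition delay_prim n theta m x : R :=
  \sum_(0 <= j < n)
    (- m) ^+ j / j.+1`!%:R * pos_part (x - j%:R * theta) ^+ j.+1.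

(** A nondecreasing function dominating the variation of [delay_fun]. *)
Definition delay_var n theta m x : R :=
  \sum_(0 <= j < n) `|(- m) ^+ j / j`!%:R| * pos_part (x - j%:R * theta) ^+ j.

(** What [delay_prim] being a primitive of [delay_fun] means here: an error
bound of the shape that [le_of_telescoping] consumes. *)
Lemma delay_prim_increment n theta m x y : 0 <= x -> x <= y ->
  `|delay_prim n theta m y - delay_prim n theta m x
    - (y - x) * delay_fun n theta m x| <=
  (y - x) * (delay_var n theta m y - delay_var n theta m x).
Proof.
move=> x0 xy; rewrite /delay_prim /delay_fun /delay_var -!sumrB !mulr_sumr -sumrB.
apply: (le_trans (ler_norm_sum _ _ _)); apply: ler_sum => -[|j] _.
  rewrite !mul0r !subr0 !pos_part_id ?(le_trans x0)//.
  by rewrite !expr0 (factS 0) !fact0 muln1 subrr mulr0 (_ : _ - _ = 0) ?normr0//; field.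
have facS : j.+2`!%:R = j.+2%:R * j.+1`!%:R :> R by rewrite factS natrM.
have fn0 : (j.+1)`!%:R != 0 :> R by rewrite pnatr_eq0 -lt0n fact_gt0.
set c := _ / j.+1`!%:R; set u := x - _; set w := y - _.
have -> : (- m) ^+ j.+1 / j.+2`!%:R = c / j.+2%:R.
  by rewrite facS /c invfM mulrCA mulrC.
have uw : u <= w by rewrite lerD2r.
have := pos_part_prim_increment j uw.
have -> : w - u = y - x by rewrite /w /u; ring.
set A := pos_part w ^+ j.+2; set B := pos_part u ^+ j.+2.
set C := pos_part w ^+ j.+1; set D := pos_part u ^+ j.+1 => H.
have -> : c / j.+2%:R * A - c / j.+2%:R * B - (y - x) * (c * D) =
   c / j.+2%:R * (A - B - (y - x) * (j.+2%:R * D)).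
  have : j.+2%:R != 0 :> R by rewrite pnatr_eq0.
  by set k := j.+2%:R => k0; field.
rewrite normrM -mulrBr normrM normfV (@ger0_norm _ j.+2%:R)//.
rewrite -mulrA [leRHS]mulrCA ler_wpM2l//.
by rewrite ler_pdivrMl ?ltr0n// [leRHS]mulrCA.
Qed.

(** The delay equation in integrated form. *)
Lemma delay_fun_shift n theta m x :
  delay_fun n.+1 theta m (x + theta) = 1 - m * delay_prim n theta m x.
Proof.
rewrite /delay_fun big_nat_recl// expr0 fact0 expr0 divr1 mulr1; congr (_ + _).
rewrite /delay_prim -mulNr mulr_sumr; apply: eq_bigr => j _.
have -> : x + theta - j.+1%:R * theta = x - j%:R * theta by rewrite -natr1; ring.
by rewrite exprS mulrA mulrA.
Qed.

Lemma delay_fun_trunc n theta m x : x <= n.+1%:R * theta ->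
  delay_fun n.+2 theta m x = delay_fun n.+1 theta m x.
Proof.
move=> xn; rewrite /delay_fun big_nat_recr//= pos_part_eq0 ?subr_le0//.
by rewrite expr0n mulr0 addr0.
Qed.

Lemma delay_fun_eq1 n theta m x : x <= theta -> 0 <= theta ->
  delay_fun n.+1 theta m x = 1.
Proof.
move=> xt t0; rewrite /delay_fun big_nat_recl// expr0 fact0 expr0 divr1 mulr1.
rewrite big1 ?addr0// => j _; rewrite pos_part_eq0 ?expr0n ?mulr0//.
by rewrite subr_le0 (le_trans xt)// ler_peMl// ler1n.
Qed.

Lemma delay_fun0 n theta x : delay_fun n.+1 theta 0 x = 1.
Proof.
rewrite /delay_fun big_nat_recl// expr0 fact0 expr0 divr1 mulr1.
by rewrite big1 ?addr0// => j _; rewrite oppr0 expr0n !mul0r.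
Qed.

(** All terms of the sum are nonnegative; hence no root of [Qtheta] is
nonpositive. *)
Lemma delay_fun_le0_ge1 n theta m x : m <= 0 -> 1 <= delay_fun n.+1 theta m x.
Proof.
move=> m0; rewrite /delay_fun big_nat_recl// expr0 fact0 expr0 divr1 mulr1.
rewrite lerDl sumr_ge0// => j _.
by rewrite mulr_ge0 ?divr_ge0 ?exprn_ge0 ?pos_part_ge0 ?oppr_ge0.
Qed.

Section monotonicity.
Context (n : nat) (theta m a b : R).
Hypotheses (a0 : 0 <= a) (ab : a <= b).
Let f := delay_fun n theta m.
Let H := delay_prim n theta m.
Let v := delay_var n theta m.

Lemma delay_prim_le_of_ge0 :
  (forall x, a <= x <= b -> 0 <= f x) -> H a <= H b.
Proof.
move=> f0; rewrite -lerN2.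
apply: (@le_of_telescoping _ (fun x => - H x) v) => // x y ax xy yb /=.
have x0 := le_trans a0 ax.
have := @delay_prim_increment n theta m x y x0 xy.
rewrite ler_norml => /andP[+ _]; rewrite -/(H y) -/(H x) -/(f x) -/(v y) -/(v x).
have : 0 <= (y - x) * f x.
  by rewrite mulr_ge0 ?subr_ge0// f0// ax (le_trans xy).
lra.
Qed.

Lemma delay_prim_le_mul C :
  (forall x, a <= x <= b -> f x <= C) -> H b - H a <= (b - a) * C.
Proof.
move=> fC; suff: H b - b * C <= H a - a * C by lra.
apply: (@le_of_telescoping _ (fun x => H x - x * C) v) => // x y ax xy yb /=.
have x0 := le_trans a0 ax.
have := @delay_prim_increment n theta m x y x0 xy.
rewrite ler_norml => /andP[_]; rewrite -/(H y) -/(H x) -/(f x) -/(v y) -/(v x).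
have : 0 <= (y - x) * (C - f x).
  by rewrite mulr_ge0 ?subr_ge0// fC// ax (le_trans xy).
lra.
Qed.

Lemma delay_prim_ge_mul C :
  (forall x, a <= x <= b -> C <= f x) -> (b - a) * C <= H b - H a.
Proof.
move=> fC; suff: b * C - H b <= a * C - H a by lra.
apply: (@le_of_telescoping _ (fun x => x * C - H x) v) => // x y ax xy yb /=.
have x0 := le_trans a0 ax.
have := @delay_prim_increment n theta m x y x0 xy.
rewrite ler_norml => /andP[+ _]; rewrite -/(H y) -/(H x) -/(f x) -/(v y) -/(v x).
have : 0 <= (y - x) * (f x - C).
  by rewrite mulr_ge0 ?subr_ge0// fC// ax (le_trans xy).
lra.
Qed.

End monotonicity.
End delay_function.

(** * The critical parameter and its eigenfunction *)

(** Joint continuity makes the set of pairs of a parameter and a point at which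
the solution is not positive compact. *)
Lemma continuous_delay_fun (R : realType) n (theta : R) :
  continuous (fun z : R * R => (delay_fun n theta z.1 z.2 : R)).
Proof.
have cont1 : continuous (fun z : R * R => - z.1).
  by move=> z; apply: cvgN; exact: cvg_fst.
have cont2 (c : R) : continuous (fun z : R * R => pos_part (z.2 - c) : R).
  move=> z; apply: (@continuous_max R (R * R)%type (fun z => z.2 - c) (cst 0)).
    by apply: cvgB; [exact: cvg_snd | exact: cvg_cst].
  exact: cvg_cst.
move=> z; rewrite /delay_fun.
apply: cvg_big => [|j _]; first exact: add_continuous.
apply: cvgM.
  apply: cvgM; last exact: cvg_cst.
  exact: (continuous_comp (cont1 z) (@exprn_continuous R j _)).
exact: (continuous_comp (cont2 _ z) (@exprn_continuous R j _)).
Qed.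

Section critical_parameter.
Context {R : realType} (theta : R).
Hypotheses (theta_gt0 : 0 < theta) (theta_le1 : theta <= 1).

Let K := Num.truncn theta^-1.
Let f := delay_fun K.+2 theta.
Let H := delay_prim K.+1 theta.
Let theta_ge0 : 0 <= theta := ltW theta_gt0.

Let K_le : K%:R * theta <= 1.
Proof.
by rewrite -ler_pdivlMr// div1r truncn_le// invr_ge0.
Qed.

Let K_gt : 1 < K.+1%:R * theta.
Proof. by rewrite -ltr_pdivrMr// div1r truncnS_gt. Qed.

(** The truncation [j <= K + 1] is where [1 + theta - j%:R * theta] is
nonnegative, so taking positive parts changes nothing. *)
Lemma Qtheta_delay_fun x : Qtheta theta x = f x (1 + theta).
Proof.
rewrite /Qtheta /f /delay_fun addn1; apply: eq_big_nat => j /andP[_ jK].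
have -> : 1 + theta - j%:R * theta = 1 - (j%:R - 1) * theta by ring.
rewrite pos_part_id//; case: j jK => [|j] jK.
  by rewrite mulr0n; have := theta_ge0; lra.
rewrite -natr1 addrK subr_ge0 (le_trans _ K_le)// ler_wpM2r// ler_nat.
by rewrite -ltnS -ltnS.
Qed.

Lemma delay_fun_prim m x : f m (x + theta) = 1 - m * H m x.
Proof. exact: delay_fun_shift. Qed.

Let f_eq1 m x : x <= theta -> f m x = 1.
Proof. by move=> xt; exact: delay_fun_eq1. Qed.

Let f_trunc m x : x <= 1 -> f m x = delay_fun K.+1 theta m x.
Proof. by move=> x1; apply: delay_fun_trunc; rewrite (le_trans x1)// ltW. Qed.

(** The decrement of [f] beyond [theta] is the integral of [m * f] over [0,1]. *)
Lemma delay_fun_nonincreasing (m : R) :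
  0 <= m -> (forall x : R, 0 <= x <= 1 -> 0 <= f m x) ->
  forall x y : R, x <= y -> y <= 1 + theta -> f m y <= f m x.
Proof.
move=> m0 f0 x y xy y1.
have [xt|xt] := leP y theta; first by rewrite !f_eq1 // (le_trans xy).
pose x' := Num.max x theta.
have -> : f m x = f m x'.
  by rewrite /x'; case: (leP x theta) => // xt'; rewrite !f_eq1.
have x'y : x' <= y by rewrite ge_max xy ltW.
have tx' : theta <= x' by rewrite le_max lexx orbT.
rewrite -[y](subrK theta) -[x'](subrK theta) !delay_fun_prim lerD2l lerN2 ler_wpM2l//.
apply: delay_prim_le_of_ge0; rewrite ?lerD2r ?subr_ge0// => z /andP[z0 z1].
have zle1 : z <= 1 by lra.
rewrite -f_trunc//; apply: f0; lra.
Qed.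

Lemma delay_fun_increment (m : R) :
  0 <= m -> (forall x : R, 0 <= x <= 1 -> 0 <= f m x) ->
  forall a b : R, 0 <= a -> a <= b -> b <= 1 ->
    m * (b - a) * f m b <= f m (a + theta) - f m (b + theta)
                        <= m * (b - a) * f m a.
Proof.
move=> m0 f0 a b a0 ab b1; rewrite !delay_fun_prim.
have anti := delay_fun_nonincreasing m0 f0.
have -> : 1 - m * H m a - (1 - m * H m b) = m * (H m b - H m a) by ring.
rewrite -!mulrA; apply/andP; split; apply: ler_wpM2l => //.
- apply: delay_prim_ge_mul => // x /andP[ax xb].
  rewrite -f_trunc; last by lra.
  by apply: anti => //; rewrite (le_trans b1)// lerDl.
- apply: delay_prim_le_mul => // x /andP[ax xb].
  rewrite -f_trunc; last by lra.
  by apply: anti => //; rewrite (le_trans (le_trans xb b1))// lerDl.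
Qed.

(** The parameter is the smallest one at which the solution takes a nonpositive
value on [0,1+theta].  The minimum exists by compactness, and the set is
nonempty because at [theta^-1] the solution vanishes at [2 * theta].  Below it
the solution is positive, so at it the solution is nonnegative by continuity in
the parameter, hence nonincreasing, and the nonpositive value somewhere forces
the value 0 at the right end. *)
Lemma exists_critical :
  exists mc : R, [/\ 0 < mc, f mc (1 + theta) = 0,
    (forall x, x <= 1 + theta -> 0 <= f mc x) &
    forall s, s < mc -> 0 < f s (1 + theta)].
Proof.
pose B : set (R * R) := `[0, theta^-1] `*` `[0, 1 + theta].
pose Z := B `&` (fun z : R * R => f z.1 z.2) @^-1` [set y | y <= 0].
have cZ : compact Z.
  apply: compact_closedI; first by apply: compact_setX; exact: segment_compact.
  apply: closed_comp; last exact: closed_le.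
  by move=> z _; exact: continuous_delay_fun.
have Z0 : Z !=set0.
  exists (theta^-1, theta + theta); split; first split => /=.
  - by rewrite in_itv/= lexx invr_ge0 theta_ge0.
  - by rewrite in_itv/=; move: theta_gt0 theta_le1; lra.
  rewrite /= delay_fun_prim /H /delay_prim big_nat_recl// big1 => [|j _].
    by rewrite mul0r subr0 pos_part_id// expr0 divr1 mul1r addr0 expr1 mulVf ?subrr// gt_eqF.
  rewrite pos_part_eq0 ?expr0n ?mulr0// subr_le0.
  by rewrite ler_peMl// ler1n.
(* Minimize the parameter over the compact set [Z]. *)
have [|[s x] /set_mem[[/= sB xB] /= fsx] smin] := @compact_EVT_min _ R fst Z Z0 cZ.
  by apply: continuous_subspaceT => z; exact: cvg_fst.
move: sB xB; rewrite !in_itv/= => /andP[s0 s1] /andP[x0 x1].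
have f_gt0 (t y : R) : t < s -> y <= 1 + theta -> 0 < f t y.
  move=> ts y1; have [t0|t0] := leP t 0.
    exact: lt_le_trans (delay_fun_le0_ge1 _ _ _ t0).
  have [y0|y0] := leP y 0; first by rewrite f_eq1// (le_trans y0).
  rewrite ltNge; apply/negP => fty.
  have /smin /= : (t, y) \in Z.
    apply/mem_set; split => //; split => /=; rewrite in_itv/=; last by rewrite y1 ltW.
    by rewrite (ltW t0) (le_trans (ltW ts)).
  by rewrite leNgt ts.
have s_gt0 : 0 < s.
  rewrite lt_neqAle s0 andbT; apply/eqP => s_eq0.
  by move: fsx; rewrite -s_eq0 /f delay_fun0 ler10.
have f_ge0 (y : R) : y <= 1 + theta -> 0 <= f s y.
  move=> y1; have c : continuous (fun t : R => f t y).
    move=> t.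
    apply: (@cvg_comp _ _ _ (fun t : R => (t, y)) (fun z : R * R => f z.1 z.2)
              (nbhs t) (nbhs (t, y))); last exact: (@continuous_delay_fun R K.+2 theta (t, y)).
    exact: (@cvg_pair _ R R (nbhs t) (nbhs t) (nbhs y) _ _ _ id (cst y) cvg_id (cvg_cst y)).
  have : f t y @[t --> s^'-] --> f s y by apply: cvg_at_left_filter; exact: c.
  move=> /cvgr_to_ge; apply.
  near=> t.
  by apply/ltW/f_gt0.
exists s; split => //; last by move=> t ts; exact: f_gt0.
apply/eqP; rewrite eq_le f_ge0// andbT (le_trans _ fsx)//.
apply: delay_fun_nonincreasing => // y /andP[y0 y1]; apply: f_ge0.
by rewrite (le_trans y1)// lerDl.
Unshelve. all: by end_near. Qed.

(** The function [phi] is an eigenfunction for the eigenvalue [mc^-1] of the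
operator [K] sending [f] to the function [x |-> int_(x - theta)^1 f], where
[f] lives on [0,1]: [phi (x + theta)] is [mc] times the integral of [phi] over
[x,1].  This is recorded by its end value and by bounds on its increments, which
determine the integral since [phi] is monotone. *)
Record eigenfunction (mc : R) (phi : R -> R) : Prop := Eigenfunction {
  eigen_mc_gt0 : 0 < mc ;
  eigen_eq1 : forall x, x <= theta -> phi x = 1 ;
  eigen_eq0 : phi (1 + theta) = 0 ;
  eigen_nonincreasing :
    forall x y : R, x <= y -> y <= 1 + theta -> phi y <= phi x ;
  eigen_increment : forall a b : R, 0 <= a -> a <= b -> b <= 1 ->
    mc * (b - a) * phi b <= phi (a + theta) - phi (b + theta)
                         <= mc * (b - a) * phi a }.

Lemma exists_eigenfunction :
  exists2 mc, minimal_root (Qtheta theta) mc & exists phi, eigenfunction mc phi.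
Proof.
have [mc [mc0 fmc f0 froot]] := exists_critical.
have f01 x : 0 <= x <= 1 -> 0 <= f mc x.
  by move=> /andP[_ x1]; apply: f0; rewrite (le_trans x1)// lerDl.
exists mc.
  split=> [|x]; rewrite Qtheta_delay_fun// => fx0.
  by rewrite leNgt; apply/negP => /froot; rewrite fx0 ltxx.
exists (f mc); split => //.
- by move=> x; exact: f_eq1.
- exact: delay_fun_nonincreasing (ltW mc0) f01.
- exact: delay_fun_increment (ltW mc0) f01.
Qed.

Section eigenfunction_theory.
Context (mc : R) (phi : R -> R).
Hypothesis eig : eigenfunction mc phi.

Lemma eigenfunction_ge0 x : x <= 1 + theta -> 0 <= phi x.
Proof. by move=> x1; rewrite -(eigen_eq0 eig); exact: (eigen_nonincreasing eig). Qed.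

Lemma eigenfunction_le1 x : 0 <= x -> x <= 1 -> phi x <= 1.
Proof.
move=> x0 x1; rewrite -(eigen_eq1 eig theta_ge0).
by apply: (eigen_nonincreasing eig) => //; rewrite (le_trans x1)// lerDl.
Qed.

(** If [phi x = 0] for some [x <= 1], then [theta < x] and the integral of the
nonnegative [phi] over [x - theta,1] is 0, so [phi] already vanishes at
[x - theta / 2].  Stepping back from 1 in this way reaches the points at which
[phi = 1]. *)
Lemma eigenfunction_gt0 : 0 < phi 1.
Proof.
have th0 := theta_gt0.
rewrite lt_neqAle eq_sym eigenfunction_ge0 ?lerDl// andbT; apply/eqP => phi10.
have back (x : R) : x <= 1 -> phi x = 0 -> theta < x /\ phi (x - theta / 2) = 0.
  move=> x1 px0; have tx : theta < x.
    rewrite ltNge; apply/negP => /(eigen_eq1 eig) px1.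
    by move: px0; rewrite px1 => /eqP; rewrite oner_eq0.
  split=> //.
  have a0 : 0 <= x - theta by rewrite subr_ge0 ltW.
  have ab : x - theta <= x - theta / 2 by lra.
  have b1 : x - theta / 2 <= 1 by lra.
  have /andP[+ _] := eigen_increment eig a0 ab b1.
  rewrite subrK px0 sub0r => h.
  have p0 : 0 <= phi (x - theta / 2) by apply: eigenfunction_ge0; lra.
  have q0 : 0 <= phi (x - theta / 2 + theta) by apply: eigenfunction_ge0; lra.
  apply/eqP; rewrite eq_le p0 andbT.
  have c0 : 0 < mc * (x - theta / 2 - (x - theta)).
    by rewrite mulr_gt0 ?(eigen_mc_gt0 eig)//; lra.
  by rewrite -(pmulr_rle0 _ c0) (le_trans h)// oppr_le0.
have all_zero k : phi (1 - k%:R * (theta / 2)) = 0.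
  elim: k => [|k IH]; first by rewrite mul0r subr0.
  have le1 : 1 - k%:R * (theta / 2) <= 1 by rewrite gerBl mulr_ge0// divr_ge0// ltW.
  have [_ <-] := back _ le1 IH.
  by congr phi; rewrite -natr1; lra.
pose k := (Num.truncn ((theta / 2)^-1)).+1.
have : 1 < k%:R * (theta / 2).
  by rewrite -ltr_pdivrMr ?divr_gt0// div1r truncnS_gt.
move=> k1; have := all_zero k; rewrite (eigen_eq1 eig); last by lra.
by move/eqP; rewrite oner_eq0.
Qed.

Let phi0 : phi 0 = 1. Proof. by rewrite (eigen_eq1 eig). Qed.
Let phitheta : phi theta = 1. Proof. by rewrite (eigen_eq1 eig). Qed.

(** One is [mc] times the integral of [phi <= 1] over [0,1]. *)
Lemma eigenfunction_mc_ge1 : 1 <= mc.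
Proof.
have /andP[_] := eigen_increment eig (lexx 0) ler01 (lexx 1).
by rewrite add0r (eigen_eq0 eig) phitheta phi0; lra.
Qed.

(** As for [eigenfunction_mc_ge1], but [phi < 1] on the second half of the
interval from [theta] to 1. *)
Lemma eigenfunction_mc_gt1 : theta < 1 -> 1 < mc.
Proof.
move=> t1; have t0 := theta_gt0; pose h := (1 + theta) / 2.
(* [h] lies strictly between [theta] and 1: [phi < 1] from there on. *)
have [h0 h1 ht] : [/\ 0 < h, h < 1 & theta < h] by split; rewrite /h; lra.
have mc0 := eigen_mc_gt0 eig.
have ph1 : phi h < 1.
  have [h'0 h'1] : 0 <= h - theta /\ h - theta <= 1 by split; lra.
  have /andP[+ _] := eigen_increment eig (lexx 0) h'0 h'1.
  rewrite add0r phitheta subrK subr0.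
  suff : 0 < mc * (h - theta) * phi (h - theta) by lra.
  rewrite !mulr_gt0 ?subr_gt0//.
  apply: lt_le_trans eigenfunction_gt0 _.
  by apply: (eigen_nonincreasing eig) => //; lra.
have /andP[_ i1] := eigen_increment eig (lexx 0) (ltW h0) (ltW h1).
have /andP[_ i2] := eigen_increment eig (ltW h0) (ltW h1) (lexx 1).
move: i1 i2; rewrite add0r phitheta phi0 (eigen_eq0 eig) => i1 i2.
have : mc * (1 - h) * phi h < mc * (1 - h) by rewrite gtr_pMr// mulr_gt0// subr_gt0.
lra.
Qed.

End eigenfunction_theory.
End critical_parameter.

(** * Hitting at least one child *)

(** The probability that [k] independent trials of success probability [p] do
not all fail. *)
Definition hit_prob (R : realType) (k : nat) (p : R) : R := 1 - (1 - p) ^+ k.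

Section hit_prob.
Context {R : realType}.
Implicit Types (k : nat) (p q : R).

Lemma hit_prob_sum k p : hit_prob k p = p * \sum_(i < k) (1 - p) ^+ i.
Proof.
by rewrite /hit_prob -opprB subrX1 -mulNr; congr (_ * _); ring.
Qed.

Lemma hit_probS k p : hit_prob k.+1 p = hit_prob k p + p * (1 - p) ^+ k.
Proof. by rewrite !hit_prob_sum big_ord_recr/= mulrDr. Qed.

Lemma hit_prob_ge0 k p : 0 <= p <= 1 -> 0 <= hit_prob k p.
Proof. by move=> ?; rewrite /hit_prob subr_ge0 exprn_ile1//; lra. Qed.

Lemma hit_prob_le1 k p : 0 <= p <= 1 -> hit_prob k p <= 1.
Proof. by move=> ?; rewrite /hit_prob gerBl exprn_ge0//; lra. Qed.

Lemma hit_prob_le_mul k p : 0 <= p <= 1 -> hit_prob k p <= k%:R * p.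
Proof.
move=> p01; rewrite hit_prob_sum mulrC ler_wpM2r//; first by lra.
rewrite -[leRHS](_ : \sum_(i < k) 1 = _); last by rewrite sumr_const card_ord.
by apply: ler_sum => i _; rewrite exprn_ile1//; lra.
Qed.

(** Two trials overlap with probability [p ^+ 2]; more trials only lose more in
the union bound. *)
Lemma hit_prob_gap k p : 0 <= p <= 1 -> (2 <= k)%N ->
  hit_prob k p + p ^+ 2 <= k%:R * p.
Proof.
move=> p01; elim: k => // k IH; rewrite ltnS leq_eqVlt => /predU1P[<-|/IH].
  by rewrite /hit_prob !expr2; lra.
rewrite hit_probS -natr1.
have : p * (1 - p) ^+ k <= p by rewrite ler_piMr ?exprn_ile1//; lra.
lra.
Qed.

(** By [hit_prob_sum], [hit_prob k p / p] is a sum of powers of [1 - p]. *)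
Lemma hit_prob_ratio k p q : 0 <= q -> q <= p -> p <= 1 ->
  hit_prob k p * q <= hit_prob k q * p.
Proof.
move=> q0 qp p1; rewrite !hit_prob_sum mulrAC [leRHS]mulrAC [q * p]mulrC.
rewrite ler_wpM2l ?mulr_ge0//; first by lra.
by apply: ler_sum => i _; rewrite lerXn2r ?nnegrE; lra.
Qed.

End hit_prob.

Section offspring.
Context {R : realType} (L : probability nat R).
Lemma integral_nat_series (f : nat -> \bar R) : (forall k, 0 <= f k)%E ->
  (\int[L]_k f k = \sum_(k <oo) f k * L [set k])%E.
Proof.
move=> f0; have UT : \bigcup_k [set k] = [set: nat].
  by apply/seteqP; split => // k _; exists k.
have tri : trivIset [set: nat] (fun k => [set k]).
  by move=> i j _ _ [k [-> ->]].
rewrite -UT (@ge0_integral_bigcup _ _ _ L (fun k => [set k]))//.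
apply: eq_eseriesr => k _; rewrite (eq_integral (cst (f k))) => [|j /set_mem -> //].
by rewrite integral_cst.
Qed.

(** With [g] the generating function of the offspring law, this is
[1 - g (1 - p)]. *)
Definition mean_hit_prob (p : R) : R := fine (\int[L]_k (hit_prob k p)%:E)%E.

Lemma mean_hit_probE p : 0 <= p <= 1 ->
  (\int[L]_k (hit_prob k p)%:E)%E = (mean_hit_prob p)%:E.
Proof.
move=> p01; rewrite /mean_hit_prob fineK// ge0_fin_numE; last first.
  by apply: integral_ge0 => k _; rewrite lee_fin hit_prob_ge0.
apply: (@le_lt_trans _ _ (\int[L]_k (cst 1%:E k))%E).
  apply: ge0_le_integral => //.
  - by move=> k _; rewrite lee_fin hit_prob_ge0.
  - by move=> k _; rewrite lee_fin hit_prob_le1.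
by rewrite integral_cst//= probability_setT mule1 ltry.
Qed.

Lemma mean_hit_prob_ge0 p : 0 <= p <= 1 -> 0 <= mean_hit_prob p.
Proof.
move=> p01; rewrite -lee_fin -mean_hit_probE//.
by apply: integral_ge0 => k _; rewrite lee_fin hit_prob_ge0.
Qed.

Lemma mean_hit_prob_ratio p q : 0 <= q -> q <= p -> p <= 1 ->
  mean_hit_prob p * q <= mean_hit_prob q * p.
Proof.
move=> q0 qp p1; have p0 := le_trans q0 qp; have q1 := le_trans qp p1.
have hp k : (0 <= (hit_prob k p)%:E)%E by rewrite lee_fin hit_prob_ge0// p0.
have hq k : (0 <= (hit_prob k q)%:E)%E by rewrite lee_fin hit_prob_ge0// q0.
rewrite -lee_fin !EFinM -!mean_hit_probE ?p0 ?q0//.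
rewrite ![(_ * _%:E)%E]muleC -!ge0_integralZl ?lee_fin//.
apply: ge0_le_integral => //.
- by move=> k _; rewrite mule_ge0.
- by move=> k _; rewrite -!EFinM lee_fin ![_ * hit_prob _ _]mulrC hit_prob_ratio.
Qed.

Context (m : R).
Hypothesis mean_L : ('E_L[fun k : nat => k%:R] = m%:E)%E.

Lemma integral_mean : (\int[L]_k (k%:R : R)%:E)%E = m%:E.
Proof. by rewrite -mean_L expectation.unlock. Qed.

Let mean_mul p : 0 <= p -> (\int[L]_k (k%:R * p)%:E)%E = (m * p)%:E.
Proof.
move=> p0; under eq_integral do rewrite EFinM muleC.
by rewrite ge0_integralZl// integral_mean -EFinM mulrC.
Qed.

Lemma mean_hit_prob_gap p : 0 <= p <= 1 ->
  ((mean_hit_prob p)%:E + (p ^+ 2)%:E * L [set k | (2 <= k)%N] <= (m * p)%:E)%E.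
Proof.
move=> p01; have /andP[p0 p1] := p01.
rewrite -mean_hit_probE// -mean_mul//.
rewrite -[X in L X]setIT -integral_indic// -ge0_integralZl ?lee_fin ?exprn_ge0//.
rewrite -ge0_integralD//; last 2 first.
- by move=> k _; rewrite lee_fin hit_prob_ge0.
- by move=> k _; rewrite -EFinM lee_fin mulr_ge0// exprn_ge0.
apply: ge0_le_integral => //.
- by move=> k _; rewrite -EFinM -EFinD lee_fin addr_ge0 ?hit_prob_ge0// mulr_ge0// exprn_ge0.
- move=> k _; rewrite -EFinM -EFinD lee_fin indicE.
  case: (boolP (k \in _)) => [/set_mem /= k2|_]; first by rewrite mulr1 hit_prob_gap.
  by rewrite mulr0 addr0 hit_prob_le_mul.
Qed.

Lemma mean_hit_prob_le p : 0 <= p <= 1 -> mean_hit_prob p <= m * p.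
Proof.
move=> p01; rewrite -lee_fin; apply: le_trans (mean_hit_prob_gap p01).
by rewrite leeDl// mule_ge0// lee_fin exprn_ge0//; case/andP: p01.
Qed.

Lemma mean_eq_of_branchless : L [set k | (2 <= k)%N] = 0%E -> L [set 1%N] = m%:E.
Proof.
move=> L2; rewrite -integral_mean.
rewrite -[LHS](_ : L ([set 1%N] `&` setT) = _); last by rewrite setIT.
rewrite -integral_indic//; apply: ge0_ae_eq_integral => //.
exists [set k | (2 <= k)%N]; split => // k /=; apply: contra_notP => /negP.
rewrite -ltnNge => k2 _; congr EFin; rewrite indicE.
case: k k2 => [|[|]]// _.
  by rewrite memNset.
by rewrite mem_set.
Qed.

(** Equality in [mean_hit_prob p <= m * p <= c * p] would force [m = c] and,
by the gap at two children, at most one child almost surely; then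
[m = L [set 1] <= 1 <= c], which is the degenerate case. *)
Lemma mean_hit_prob_lt (c p : R) : m <= c -> 1 <= c ->
  1 < c \/ L [set 1%N] <> 1%E -> 0 < p <= 1 -> mean_hit_prob p < c * p.
Proof.
move=> mc c1 degen p01; have /andP[p0 p1] := p01.
have p01' : 0 <= p <= 1 by rewrite ltW.
rewrite lt_neqAle (le_trans (mean_hit_prob_le p01')) ?ler_pM2r// andbT.
apply/eqP => Gcp.
have mc' : m = c.
  apply/eqP; rewrite eq_le mc/= -(ler_pM2r p0) -Gcp; exact: mean_hit_prob_le.
have := mean_hit_prob_gap p01'; rewrite Gcp -mc'.
rewrite -leeBrDl// subee// => L2.
have {}L2 : L [set k | (2 <= k)%N] = 0%E.
  apply/eqP; rewrite eq_le measure_ge0 andbT.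
  by rewrite pmule_rle0 // in L2; rewrite lte_fin exprn_gt0.
have L1 := mean_eq_of_branchless L2.
case: degen => [c1'|].
  have : (L [set 1%N] <= 1)%E by exact: probability_le1.
  by rewrite L1 lee_fin leNgt mc' c1'.
apply; rewrite L1 mc'; congr EFin; apply/eqP; rewrite eq_le c1 andbT.
by rewrite -mc' -lee_fin -L1 probability_le1.
Qed.

(** The quotient [mean_hit_prob p / p] increases to [m] as [p] decreases to 0, by
monotone convergence. *)
Lemma mean_hit_prob_gt (c : R) : c < m ->
  exists2 p, 0 < p <= 1 & c * p <= mean_hit_prob p.
Proof.
move=> cm.
(* [g j k] is [hit_prob k p / p] at [p = 1 / (j + 1)], which increases to [k]. *)
pose g (j k : nat) : \bar R := (\sum_(i < k) (1 - harmonic j) ^+ i)%:E.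
have h01 j : 0 < (harmonic j : R) <= 1.
  by rewrite /harmonic invr_gt0 ltr0n invf_le1 ?ltr0n// ler1n.
have h01' j : 0 <= 1 - (harmonic j : R) <= 1.
  by have := h01 j; lra.
have g_cvg k : g j k @[j --> \oo] --> (k%:R : R)%:E.
  apply: cvg_EFin; first by near=> j.
  have -> : (k%:R : R) = \sum_(i < k) (1 - 0) ^+ i.
    by rewrite subr0; under eq_bigr do rewrite expr1n; rewrite sumr_const card_ord.
  apply: cvg_big => [|i _]; first exact: add_continuous.
  apply: (@cvg_comp _ _ _ (fun j => 1 - harmonic j) (fun x : R => x ^+ i)
            \oo (nbhs (1 - 0 : R))).
    by apply: cvgB; [exact: cvg_cst|exact: cvg_harmonic].
  exact: exprn_continuous.
have cvg_g : (\int[L]_k g j k)%E @[j --> \oo] --> (\int[L]_k (k%:R : R)%:E)%E.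
  have -> : (\int[L]_k (k%:R : R)%:E = \int[L]_k limn (g ^~ k))%E.
    by apply: eq_integral => k _; apply/esym/cvg_lim => //; exact: g_cvg.
  apply: cvg_monotone_convergence => //.
  - move=> j k _; rewrite lee_fin sumr_ge0// => i _; rewrite exprn_ge0//.
    by case/andP: (h01' j).
  - move=> k _ a b ab; rewrite lee_fin; apply: ler_sum => i _.
    rewrite lerXn2r ?nnegrE//; [by case/andP: (h01' a)|by case/andP: (h01' b)|].
    by rewrite lerD2l lerN2 /harmonic lef_pV2 ?posrE ?ltr0n// ler_nat.
rewrite integral_mean in cvg_g.
have [j cj] : exists j, (c%:E < \int[L]_k g j k)%E.
  have /cvg_g [j _ /(_ j (leqnn j)) /= cj] : nbhs m%:E [set y | c%:E < y]%E.
    by apply: open_ereal_gt'; rewrite lte_fin.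
  by exists j.
exists (harmonic j) => //; have /andP[h0 h1] := h01 j.
have h01j : 0 <= (harmonic j : R) <= 1 by rewrite ltW.
rewrite -lee_fin -mean_hit_probE//.
under eq_integral do rewrite hit_prob_sum EFinM.
rewrite ge0_integralZl//; last 2 first.
- by move=> k _; rewrite lee_fin sumr_ge0// => i _; rewrite exprn_ge0//; case/andP: (h01' j).
- by rewrite lee_fin ltW.
by rewrite mulrC EFinM lee_pmul2l// ltW.
Unshelve. all: by end_near. Qed.

End offspring.

(** * Independence of disjoint blocks *)

Section block_independence.
Context d (Omega : measurableType d) (R : realType) (P : probability Omega R).
Context (I : choiceType) (F : I -> set (set Omega)).

(** Finite intersections of events with indices in [S]: the pi-system to which
mutual independence speaks directly. *)
Definition cylinder (S : set I) : set (set Omega) :=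
  [set A | exists J : {fset I}, [set` J] `<=` S /\
    exists2 B : I -> set Omega, (forall i, i \in J -> F i (B i)) &
      A = \bigcap_(i in [set` J]) B i].

(** The events that only depend on the coordinates in [S]. *)
Definition block (S : set I) : set (set Omega) := <<s cylinder S >>.

Lemma block_sigma_algebra S : sigma_algebra setT (block S).
Proof. exact: smallest_sigma_algebra. Qed.

Lemma blockC S A : block S A -> block S (~` A).
Proof. by move=> SA; rewrite -setTD; case: (block_sigma_algebra S) => _ /(_ _ SA). Qed.

Lemma block_bigcup S (A : nat -> set Omega) :
  (forall n, block S (A n)) -> block S (\bigcup_n A n).
Proof. by case: (block_sigma_algebra S) => _ _; apply. Qed.

Lemma block0 S : block S set0.
Proof. by case: (block_sigma_algebra S). Qed.

Lemma blockT S : block S setT.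
Proof. by rewrite -setC0; apply: blockC; exact: block0. Qed.

Lemma block_bigcap S (A : nat -> set Omega) :
  (forall n, block S (A n)) -> block S (\bigcap_n A n).
Proof.
move=> mA; rewrite -[X in block S X]setCK setC_bigcap.
by apply: blockC; apply: block_bigcup => n; apply: blockC; exact: mA.
Qed.

Lemma blockI S A B : block S A -> block S B -> block S (A `&` B).
Proof.
by move=> mA mB; rewrite -bigcap2E; apply: block_bigcap => -[|[|n]] //=; exact: blockT.
Qed.

Lemma block_sub S S' : S `<=` S' -> block S `<=` block S'.
Proof.
move=> SS'; apply: smallest_sub; first exact: block_sigma_algebra.
move=> _ [J [JS [B FB ->]]]; apply: sub_sigma_algebra.
by exists J; split; [exact: subset_trans SS' | exists B].
Qed.

Lemma block_gen S i A : S i -> F i A -> block S A.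
Proof.
move=> Si FA; apply: sub_sigma_algebra; exists [fset i]%fset; split.
  by move=> j /=; rewrite inE => /eqP ->.
exists (fun=> A); first by move=> j; rewrite inE => /eqP ->.
by rewrite bigcap_const//; exists i; rewrite /= inE.
Qed.

Hypothesis F_measurable : forall i, F i `<=` measurable.

Lemma block_measurable S : block S `<=` measurable.
Proof.
apply: smallest_sub; first exact: sigma_algebra_measurable.
move=> _ [J [_ [B FB ->]]].
by apply: fin_bigcap_measurable => // i /= iJ; apply/F_measurable/FB.
Qed.

Hypothesis F_setI : forall i, setI_closed (F i).
Hypothesis F_setT : forall i, F i setT.

Lemma cylinder_setI S : setI_closed (cylinder S).
Proof.
move=> _ _ [J1 [J1S [B1 FB1 ->]]] [J2 [J2S [B2 FB2 ->]]].
exists (J1 `|` J2)%fset; split.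
  by move=> i /=; rewrite in_fsetU => /orP[/J1S|/J2S].
exists (fun i => (if i \in J1 then B1 i else setT) `&`
                 (if i \in J2 then B2 i else setT)).
  by move=> i _; apply: F_setI; case: ifPn => //; [exact: FB1|exact: FB2].
apply/seteqP; split=> [w [w1 w2] i /= _|w wB].
  by split; case: ifPn => // iJ; [exact: w1 | exact: w2].
split=> i /= iJ.
  by have := wB i; rewrite /= in_fsetU iJ => /(_ isT)[].
by have := wB i; rewrite /= in_fsetU iJ orbT => /(_ isT)[_].
Qed.

Hypothesis indepF : mutually_independent P F.

Lemma cylinder_independent S1 S2 A B : S1 `&` S2 = set0 ->
  cylinder S1 A -> cylinder S2 B -> P (A `&` B) = (P A * P B)%E.
Proof.
move=> S120 [J1 [J1S [B1 FB1 ->]]] [J2 [J2S [B2 FB2 ->]]].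
have J12 i : i \in J1 -> i \in J2 -> False.
  by move=> /J1S i1 /J2S i2; rewrite -[False]/(set0 i) -S120.
pose C i := if i \in J1 then B1 i else B2 i.
have -> : \bigcap_(i in [set` J1]) B1 i `&` \bigcap_(i in [set` J2]) B2 i =
          \bigcap_(i in [set` (J1 `|` J2)%fset]) C i.
  apply/seteqP; split=> [w [w1 w2] i /=|w wC].
    rewrite in_fsetU /C; case: (boolP (i \in J1)) => [iJ _|_ /= iJ]; [exact: w1|exact: w2].
  split=> i /= iJ.
    by have := wC i; rewrite /= /C in_fsetU iJ; exact.
  have := wC i; rewrite /= /C in_fsetU iJ orbT => /(_ isT).
  by case: ifPn => // iJ1; have := J12 i iJ1 iJ.
have FC i : i \in (J1 `|` J2)%fset -> F i (C i).
  by rewrite in_fsetU /C; case: (boolP (i \in J1)) => [iJ _|_ /= iJ]; [exact: FB1|exact: FB2].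
rewrite (indepF FC) (indepF FB1) (indepF FB2) (big_fsetID _ (mem J1)) /=.
congr (_ * _)%E.
  have -> : [fset x in (J1 `|` J2)%fset | x \in J1]%fset = J1.
    by apply/fsetP => i; rewrite !inE/=; case: (i \in J1); rewrite ?andbT ?andbF.
  by apply: eq_big_seq => i iJ; rewrite /C iJ.
have -> : [fset x in (J1 `|` J2)%fset | x \notin J1]%fset = J2.
  apply/fsetP => i; rewrite !inE; case: (boolP (i \in J1)) => //= iJ1.
    by apply/esym/negP; exact: J12.
  by rewrite andbT.
by apply: eq_big_seq => i iJ; rewrite /C; case: ifPn => // iJ1; have := J12 i iJ1 iJ.
Qed.

(** For a fixed [B], the events independent of [B] form a Dynkin system. *)
Lemma independent_of_pi_system (G : set (set Omega)) B :
  G `<=` measurable -> setI_closed G -> measurable B ->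
  (forall A, G A -> P (A `&` B) = (P A * P B)%E) ->
  forall A, <<s G >> A -> P (A `&` B) = (P A * P B)%E.
Proof.
move=> Gm GI mB GB.
suff : <<s G >> `<=` [set A | measurable A /\ P (A `&` B) = (P A * P B)%E].
  by move=> + A => /[apply] -[].
rewrite -setI_closed_g_dynkin_g_sigma_algebra//.
apply: smallest_sub => [|A GA]; last by split; [exact: Gm | exact: GB].
have Bfin : P B \is a fin_num by exact: fin_num_measure.
split => /=.
- by rewrite setTI probability_setT mul1e.
- move=> A [mA PA]; split; first exact: measurableC.
  have Afin : P A \is a fin_num by exact: fin_num_measure.
  rewrite setIC -setDE measureD//; last by rewrite ltey_eq Bfin.
  by rewrite setIC [X in (_ - X)%E]PA probability_setC// muleBl// mul1e.
- move=> A tA PA; have mA n : measurable (A n) by case: (PA n).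
  split; first exact: bigcupT_measurable.
  rewrite setI_bigcupl measure_bigcup//=; last 2 first.
  + by move=> n _; exact: measurableI.
  + by apply: trivIset_setIr.
  rewrite measure_bigcup// [in RHS]muleC -(fineK Bfin) -nneseriesZl//.
  by apply: eq_eseriesr => n _; case: (PA n) => _; rewrite muleC (fineK Bfin).
Qed.

(** The pi-lambda argument applied to one factor, then to the other. *)
Theorem block_independent S1 S2 A B : S1 `&` S2 = set0 ->
  block S1 A -> block S2 B -> P (A `&` B) = (P A * P B)%E.
Proof.
move=> S120 SA SB.
have cm S : cylinder S `<=` measurable.
  by move=> C SC; apply: (@block_measurable S); exact: sub_sigma_algebra.
apply: (independent_of_pi_system (@cm S1) (@cylinder_setI S1)) SA.
  exact: block_measurable SB.
move=> C SC; rewrite setIC muleC.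
apply: (independent_of_pi_system (@cm S2) (@cylinder_setI S2)) SB.
  exact: cm SC.
by move=> D SD; rewrite setIC muleC; exact: cylinder_independent SC SD.
Qed.

End block_independence.

(** * Increasing paths in a deterministic tree *)

Lemma prefix_rconsr (T : eqType) (s t : seq T) x :
  prefix s (rcons t x) = prefix s t || (s == rcons t x).
Proof.
elim: t s => [|y t IH] [|z s] //=.
by rewrite IH eqseq_cons -andb_orr.
Qed.

Section increasing_paths.
Context (R : realType) (theta : R) (N : seq nat -> nat) (U : seq nat -> R).
Implicit Types (v u : seq nat) (x y : R).

(** An increasing path of length [n] starts downwards from a vertex [v] whose
label is replaced by [x].  Keeping [x] apart from [U v] makes the condition
depend on the strict descendants of [v] only, hence independent of [U v]. *)
Fixpoint reach (n : nat) (v : seq nat) (x : R) : Prop :=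
  if n is n'.+1 then
    exists2 i, (i < N v)%N &
      x - theta < U (rcons v i) /\ reach n' (rcons v i) (U (rcons v i))
  else True.

Lemma reach_anti n v x y : x <= y -> reach n v y -> reach n v x.
Proof.
case: n => // n xy [i iN [yU r]]; exists i => //; split => //.
by apply: le_lt_trans yU; rewrite lerD2r.
Qed.

(** Only the first step of the path bounds [x], by a strict inequality.  This lets
[x] be replaced by a rational number where [x] is random. *)
Lemma reach_open n v x : reach n v x -> exists2 y, x < y & reach n v y.
Proof.
case: n => [_|n [i iN [xU r]]]; first by exists (x + 1) => //; rewrite ltrDl.
exists ((x + (U (rcons v i) + theta)) / 2); first by lra.
by exists i => //; split => //; lra.
Qed.

Lemma reach_pred n v x : reach n.+1 v x -> reach n v x.
Proof.
elim: n v x => [//|n IH] v x [i iN [xU r]].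
by exists i => //; split => //; exact: IH.
Qed.

Lemma reach_le k n v x : (k <= n)%N -> reach n v x -> reach k v x.
Proof.
elim: n => [|n IH]; first by rewrite leqn0 => /eqP ->.
by rewrite leq_eqVlt => /predU1P[->//|kn] /reach_pred; exact: IH.
Qed.

(** The step of the argument of König: if every child failed at some depth, all
would fail at the maximum of these finitely many depths. *)
Lemma reach_konig v x : (forall n, reach n v x) ->
  exists i, [/\ (i < N v)%N, x - theta < U (rcons v i) &
               forall n, reach n (rcons v i) (U (rcons v i))].
Proof.
move=> rv; apply: contrapT => noi.
have bad i : exists n, (i < N v)%N -> x - theta < U (rcons v i) ->
    ~ reach n (rcons v i) (U (rcons v i)).
  apply: contrapT => /forallNP h; apply: noi; exists i; split.
  - by apply: contrapT => iN; apply: (h 0%N) => /iN.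
  - by apply: contrapT => xU; apply: (h 0%N) => _ /xU.
  - by move=> n; apply: contrapT => nr; apply: (h n).
have [f fP] := choice bad.
pose m := (\max_(i < N v) f i)%N.
have [i iN [xU r]] := rv m.+1.
apply: (fP i iN xU); apply: reach_le r.
exact: (@leq_bigmax _ (fun i => f (nat_of_ord i)) (Ordinal iN)).
Qed.

Lemma rmf_label_lt v i : (rmf_label theta U v < rmf_label theta U (rcons v i)) =
  (U v - theta < U (rcons v i)).
Proof.
rewrite /rmf_label size_rcons -natr1; apply/idP/idP; lra.
Qed.

(** A self-avoiding path from the root cannot return to a parent, so each step
goes to a child. *)
Lemma percolates_reach : percolates (gw_tree N) (rmf_label theta U) ->
  forall n, reach n [::] (U [::]).
Proof.
move=> [v [v0 vT vadj vinj vlt]].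
have vS n : exists i, v n.+1 = rcons (v n) i.
  elim: n => [|n [j vj]].
    have [i [vi|]] := vadj 0%N; first by exists i.
    by rewrite v0; case: (v 1%N).
  have [i [vi|]] := vadj n.+1; first by exists i.
  rewrite vj => /rcons_inj[/vinj] /eqP.
  by rewrite -[X in X == _]addn0 -addn2 eqn_add2l.
suff r k n : reach k (v n) (U (v n)) by move=> n; rewrite -v0; exact: r.
elim: k n => // k IH n; have [i vi] := vS n; exists i.
  by have := vT n.+1; rewrite vi => /(_ (v n) i (prefix_refl _)).
by rewrite -rmf_label_lt -vi; split.
Qed.

Lemma gw_tree_rcons v i : gw_tree N v -> (i < N v)%N -> gw_tree N (rcons v i).
Proof.
move=> Tv iN u j; rewrite prefix_rconsr => /orP[/Tv//|/eqP].
by move=> /rcons_inj[-> ->].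
Qed.

Lemma reach_percolates : (forall n, reach n [::] (U [::])) ->
  percolates (gw_tree N) (rmf_label theta U).
Proof.
move=> r0; pose inf v := forall n, reach n v (U v).
have step v : exists i, inf v -> [/\ (i < N v)%N, U v - theta < U (rcons v i) &
                                    inf (rcons v i)].
  have [iv|niv] := pselect (inf v); last by exists 0%N.
  by have [i iP] := reach_konig iv; exists i.
have [f fP] := choice step.
pose v := fun n => iter n (fun w => rcons w (f w)) ([::] : seq nat).
have vinf n : inf (v n) by elim: n => [//|n IH]; have [] := fP _ IH.
have vsize n : size (v n) = n by elim: n => //= n IH; rewrite size_rcons IH.
exists v; split => //.
- elim=> [|n IH]; first by move=> [|a u] i.
  by apply: gw_tree_rcons => //; have [] := fP _ (vinf n).
- by move=> n; exists (f (v n)); left.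
- by move=> a b ab; rewrite -(vsize a) ab vsize.
- by move=> n; rewrite rmf_label_lt; have [] := fP _ (vinf n).
Qed.

End increasing_paths.

(** * The random tree with its labels *)

Section generated_sigma.
Context d d' (Omega : measurableType d) (T : measurableType d').
Context (X : {mfun Omega >-> T}).

Lemma generated_sigma_preimage A : measurable A -> generated_sigma X (X @^-1` A).
Proof. by move=> mA; exists A => //; rewrite setTI. Qed.

Lemma generated_sigma_measurable : generated_sigma X `<=` measurable.
Proof. by move=> _ [A mA <-]; exact: measurable_funP. Qed.

Lemma generated_sigma_setI : setI_closed (generated_sigma X).
Proof.
move=> _ _ [A mA <-] [B mB <-]; rewrite !setTI -preimage_setI.
by apply: generated_sigma_preimage; exact: measurableI.
Qed.

Lemma generated_sigma_setT : generated_sigma X setT.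
Proof. by rewrite -[X in _ X](preimage_setT X); exact: generated_sigma_preimage. Qed.

End generated_sigma.

Lemma uniform_prob_itv (R : realType) (a b : R) : 0 <= a -> a <= b -> b <= 1 ->
  uniform_prob (@ltr01 R) `]a, b] = (b - a)%:E.
Proof.
move=> a0 ab b1; rewrite /uniform_prob integral_uniform_pdf setIidl; last first.
  move=> x /=; rewrite !in_itv/= => /andP[ax xb].
  by rewrite (le_trans a0 (ltW ax)) (le_trans xb).
rewrite (eq_integral (cst 1%:E)) => [|x /set_mem /=]; last first.
  rewrite in_itv/= => /andP[ax xb].
  by rewrite /uniform_pdf (le_trans a0 (ltW ax)) (le_trans xb)// subr0 invr1.
rewrite integral_cst//= lebesgue_measure_itv/= lte_fin mul1e.
move: ab; rewrite le_eqVlt => /predU1P[->|->]; first by rewrite ltxx subrr.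
by rewrite EFinB.
Qed.

Section model.
Context d (Omega : measurableType d) (R : realType) (P : probability Omega R).
Context (theta : R) (L : probability nat R).
Context (N : seq nat -> {RV P >-> nat}) (U : seq nat -> {RV P >-> R}).
Hypothesis model : gw_rmf L N U.

Let F (i : seq nat + seq nat) : set (set Omega) :=
  match i with
  | inl v => generated_sigma (N v)
  | inr v => generated_sigma (U v)
  end.

Let F_measurable i : F i `<=` measurable.
Proof. by case: i => v; exact: generated_sigma_measurable. Qed.

Let F_setI i : setI_closed (F i).
Proof. by case: i => v; exact: generated_sigma_setI. Qed.

Let F_setT i : F i setT.
Proof. by case: i => v; exact: generated_sigma_setT. Qed.

Let F_indep : mutually_independent P F.
Proof. exact: (gw_rmf_independent model). Qed.

Definition pr (A : set Omega) : R := fine (P A).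

Lemma prE A : measurable A -> P A = (pr A)%:E.
Proof. by move=> mA; rewrite fineK// fin_num_measure. Qed.

Lemma pr_ge0 A : 0 <= pr A.
Proof. exact: fine_ge0. Qed.

Lemma pr_le1 A : measurable A -> pr A <= 1.
Proof. by move=> mA; rewrite -lee_fin -prE// probability_le1. Qed.

Lemma le_pr A B : measurable A -> measurable B -> A `<=` B -> pr A <= pr B.
Proof. by move=> mA mB AB; rewrite -lee_fin -!prE// le_measure// inE. Qed.

Lemma prD A B : measurable A -> measurable B -> B `<=` A ->
  pr (A `\` B) = pr A - pr B.
Proof.
move=> mA mB BA; apply: EFin_inj; rewrite -prE; last exact: measurableD.
have -> : P (A `\` B) = (P A - P (A `&` B))%E.
  by apply: measureD => //; rewrite ltey_eq fin_num_measure.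
by rewrite (setIidr BA) (prE mA) (prE mB).
Qed.

Local Notation blk := (block F).

Let blk_measurable S : blk S `<=` measurable.
Proof. exact: block_measurable. Qed.

Lemma pr_independent S1 S2 A B : S1 `&` S2 = set0 -> blk S1 A -> blk S2 B ->
  pr (A `&` B) = pr A * pr B.
Proof.
move=> S12 SA SB; apply: EFin_inj; rewrite EFinM -!prE.
- exact: (block_independent F_measurable F_setI F_setT F_indep S12).
- exact: blk_measurable SB.
- exact: blk_measurable SA.
- by apply: measurableI; [exact: blk_measurable SA|exact: blk_measurable SB].
Qed.

(** The indices of the random variables that the vertices at or below [v]
carry. *)
Definition subtree (v : seq nat) : set (seq nat + seq nat) :=
  [set i | match i with inl w | inr w => prefix v w end].

(** The indices of the random variables on which [reach n v x] depends when [x]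
is fixed. *)
Definition below (v : seq nat) : set (seq nat + seq nat) :=
  subtree v `\` [set inr v].

Definition reach_event n v x : set Omega :=
  [set w | reach theta (fun v => N v w) (fun v => U v w) n v x].

(** The vertex [v] has label above [s] and is good to depth [n]; for a child of a
vertex with label [x] this is what is asked with [s = x - theta]. *)
Definition above_reach n v s : set Omega :=
  [set w | s < U v w /\ reach theta (fun v => N v w) (fun v => U v w) n v (U v w)].

Lemma reach_eventS n v x : reach_event n.+1 v x =
  \bigcup_i (N v @^-1` [set k | (i < k)%N] `&` above_reach n (rcons v i) (x - theta)).
Proof.
apply/seteqP; split => [w [i iN [xU r]]|w [i _ [iN [xU r]]]]; first by exists i.
by exists i.
Qed.

Lemma blk_U S v A : S (inr v) -> measurable A -> blk S (U v @^-1` A).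
Proof. by move=> Sv mA; apply: (block_gen Sv); exact: generated_sigma_preimage. Qed.

Lemma blk_N S v A : S (inl v) -> blk S (N v @^-1` A).
Proof. by move=> Sv; apply: (block_gen Sv); exact: generated_sigma_preimage. Qed.

Lemma subtree_rcons v i : subtree (rcons v i) `<=` below v.
Proof.
have pv w : prefix (rcons v i) w -> prefix v w.
  by move=> /prefixP[u ->]; rewrite cat_rcons prefix_prefix.
move=> [w|w] /= vw; split => /=; do ?[exact: pv].
  by case.
move=> [wv]; move: vw; rewrite wv => /prefixP[u] /(congr1 size)/eqP.
by rewrite size_cat size_rcons -[X in X == _]addn0 addSnnS eqn_add2l.
Qed.

(** A random threshold is not allowed in [reach_event]; since goodness persists
at slightly larger labels, a rational number separates [U v] from the
threshold, and countably many suffice. *)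
Lemma above_reach_split n v s : above_reach n.+1 v s =
  U v @^-1` `]s, +oo[ `&` \bigcup_k
    (if (choice.unpickle k : option rat) is Some q then
       U v @^-1` `]-oo, ratr q[ `&` reach_event n.+1 v (ratr q)
     else set0).
Proof.
apply/seteqP; split => [w [sU r]|w /= [sU [k _]]].
  split; first by rewrite /= in_itv/= sU.
  have [y Uy ry] := reach_open r.
  have [q] := rat_in_itvoo Uy; rewrite in_itv/= => /andP[Uq qy].
  have [k kq] : exists k, choice.unpickle k = Some q.
    by exists (choice.pickle q); rewrite choice.pickleK.
  exists k; [exact: I | rewrite kq; split; first by rewrite /= in_itv].
  by apply: reach_anti ry; exact: ltW.
case: (choice.unpickle k) => // q [Uq r]; split.
  by move: sU; rewrite in_itv/= andbT.
by apply: reach_anti r; move: Uq; rewrite /= in_itv/= => /ltW.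
Qed.

(** Stated conditionally so that it can serve inside the induction of
[blk_reach]. *)
Lemma blk_above_of_reach n v s :
  (forall x, blk (below v) (reach_event n v x)) ->
  blk (subtree v) (above_reach n v s).
Proof.
have vv : subtree v (inr v) by exact: prefix_refl.
case: n => [_|n IH].
  rewrite (_ : above_reach _ _ _ = U v @^-1` `]s, +oo[); first exact: blk_U.
  by apply/seteqP; split => w; rewrite /= in_itv/= andbT; [case|].
rewrite above_reach_split; apply: blockI; first exact: blk_U.
apply: block_bigcup => k; case: (choice.unpickle k) => [q|]; last exact: block0.
apply: blockI; first exact: blk_U.
by apply: (@block_sub _ _ _ _ (below v)) (IH _) => j [].
Qed.

Lemma blk_reach n v x : blk (below v) (reach_event n v x).
Proof.
elim: n v x => [|n IH] v x.
  by rewrite (_ : reach_event _ _ _ = setT); [exact: blockT | exact/seteqP].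
rewrite reach_eventS; apply: block_bigcup => i.
apply: blockI; first by apply: blk_N; split => //=; exact: prefix_refl.
apply: (block_sub (@subtree_rcons v i)).
exact: blk_above_of_reach.
Qed.

Lemma blk_above n v s : blk (subtree v) (above_reach n v s).
Proof. by apply: blk_above_of_reach => x; exact: blk_reach. Qed.

Lemma measurable_above_reach n v s : measurable (above_reach n v s).
Proof. exact: blk_measurable (blk_above _ _). Qed.

Let above_measurable := measurable_above_reach.

Let reach_measurable n v x : measurable (reach_event n v x).
Proof. exact: blk_measurable (blk_reach _ _). Qed.

Let U_measurable v A : measurable A -> measurable (U v @^-1` A).
Proof. by move=> mA; rewrite -[X in measurable X]setTI; exact: measurable_funP. Qed.

Lemma pr_U_itv v (a b : R) : 0 <= a -> a <= b -> b <= 1 ->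
  pr (U v @^-1` `]a, b]) = b - a.
Proof.
move=> a0 ab b1; apply: EFin_inj; rewrite -prE; last exact: U_measurable.
by rewrite -(uniform_prob_itv a0 ab b1) -(gw_rmf_uniform model v).
Qed.

Lemma pr_U_outside v : pr (~` (U v @^-1` `]0, 1])) = 0.
Proof.
rewrite -setTD prD//; last exact: U_measurable.
by rewrite pr_U_itv// subr0 /pr probability_setT subrr.
Qed.

(** The event is lost between levels [a] and [b] when [a < U v <= b] and [v]
is good; goodness is monotone in the label and independent of [U v].  Thus
[pr (above_reach n v s)] is the integral over [s,1] of the probability of
goodness, in the form that [le_of_telescoping] uses. *)
Lemma pr_above_increment n v (a b : R) : 0 <= a -> a <= b -> b <= 1 ->
  (b - a) * pr (reach_event n v b) <=
  pr (above_reach n v a) - pr (above_reach n v b) <=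
  (b - a) * pr (reach_event n v a).
Proof.
move=> a0 ab b1; have mU := U_measurable v (measurable_itv `]a, b]).
have ind x : pr (U v @^-1` `]a, b] `&` reach_event n v x) =
    (b - a) * pr (reach_event n v x).
  rewrite -(pr_U_itv v a0 ab b1).
  apply: (@pr_independent [set inr v] (below v)) (blk_reach _ _).
    by apply/seteqP; split => // j [-> [_ nj]]; exact: nj.
  exact: blk_U.
have sub : above_reach n v b `<=` above_reach n v a.
  by move=> w [bU r]; split => //; exact: le_lt_trans bU.
rewrite -prD// -!ind; apply/andP; split; apply: le_pr.
- exact: measurableI.
- exact: measurableD.
- move=> w [] /=; rewrite in_itv/= => /andP[aU Ub] r; split.
    by split => //; exact: reach_anti r.
  by move=> [bU _]; move: Ub; rewrite leNgt bU.
- exact: measurableD.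
- exact: measurableI.
- move=> w [[aU r] nb]; split.
    rewrite /= in_itv/= aU /= leNgt; apply/negP => bU; exact: nb.
  by apply: reach_anti r; exact: ltW.
Qed.

Lemma pr_above_ge1 n v : pr (above_reach n v 1) = 0.
Proof.
apply/eqP; rewrite eq_le pr_ge0 andbT -(pr_U_outside v) le_pr//.
  exact/measurableC/U_measurable.
move=> w [U1 _] /=; rewrite in_itv/= => /andP[_].
by rewrite leNgt U1.
Qed.

(** A negative level is as good as the level 0, labels being positive almost
surely. *)
Lemma pr_above_max n v s : pr (above_reach n v (Num.max s 0)) = pr (above_reach n v s).
Proof.
case: (leP s 0) => // s0; apply/eqP; rewrite eq_le; apply/andP; split.
  by apply: le_pr => // w [U0 r]; split => //; exact: le_lt_trans U0.
rewrite -subr_le0 -prD//; last by move=> w [U0 r]; split => //; exact: le_lt_trans U0.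
rewrite -[leRHS](pr_U_outside v) le_pr//; [exact: measurableD|exact/measurableC/U_measurable|].
move=> w [[sU r] n0] /=; rewrite in_itv/= => /andP[U0 _].
by apply: n0; split.
Qed.

Section comparison.
Context (mc : R) (phi : R -> R).
Hypothesis eig : eigenfunction theta mc phi.
Context (n : nat) (v : seq nat) (c : R).
Hypothesis c0 : 0 <= c.

Let phi_max s : phi (Num.max s 0 + theta) = phi (s + theta).
Proof.
case: (leP s 0) => // s0; rewrite add0r !(eigen_eq1 eig)//.
by rewrite gerDr.
Qed.

Let mc0 : 0 < mc := eigen_mc_gt0 eig.

Let phi_increment a b : 0 <= a -> a <= b -> b <= 1 ->
  (b - a) * (c * phi b) <= c / mc * phi (a + theta) - c / mc * phi (b + theta) <=
  (b - a) * (c * phi a).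
Proof.
move=> a0 ab b1; have /andP[lo hi] := eigen_increment eig a0 ab b1.
have k0 : 0 <= c / mc by rewrite divr_ge0// ltW.
have e z : (b - a) * (c * z) = c / mc * (mc * (b - a) * z).
  by field; rewrite gt_eqF.
by rewrite -mulrBr !e !ler_wpM2l.
Qed.

Let phi_end : phi (1 + theta) = 0 := eigen_eq0 eig.

(** Both sides vanish at [s = 1], and the increments of the left side are bounded
by those of the right. *)
Lemma pr_above_le s : s <= 1 ->
  (forall x : R, 0 <= x <= 1 -> pr (reach_event n v x) <= c * phi x) ->
  pr (above_reach n v s) <= c / mc * phi (s + theta).
Proof.
move=> s1 bnd; rewrite -pr_above_max -phi_max; set t := Num.max s 0.
have t0 : 0 <= t by rewrite le_max lexx orbT.
have t1 : t <= 1 by rewrite ge_max s1 ler01.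
pose D x := c / mc * phi (x + theta) - pr (above_reach n v x).
rewrite -subr_ge0 -/(D t).
have <- : D 1 = 0 by rewrite /D phi_end mulr0 pr_above_ge1 subrr.
apply: (@le_of_telescoping _ D (fun x => - (c * phi x))) => // x y tx xy y1.
have x0 := le_trans t0 tx.
have /andP[lo _] := phi_increment x0 xy y1.
have /andP[_ hi] := pr_above_increment n v x0 xy y1.
have : (y - x) * pr (reach_event n v x) <= (y - x) * (c * phi x).
  by rewrite ler_wpM2l ?subr_ge0// bnd// x0 (le_trans xy).
rewrite /D; set A := c / mc * _ in lo *; set B := c / mc * _ in lo *.
set h := pr _ in hi *; set h' := pr _ in hi *; lra.
Qed.

(** The same comparison as in [pr_above_le], with the inequalities reversed. *)
Lemma pr_above_ge s : s <= 1 ->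
  (forall x : R, 0 <= x <= 1 -> c * phi x <= pr (reach_event n v x)) ->
  c / mc * phi (s + theta) <= pr (above_reach n v s).
Proof.
move=> s1 bnd; rewrite -pr_above_max -phi_max; set t := Num.max s 0.
have t0 : 0 <= t by rewrite le_max lexx orbT.
have t1 : t <= 1 by rewrite ge_max s1 ler01.
pose D x := pr (above_reach n v x) - c / mc * phi (x + theta).
rewrite -subr_ge0 -/(D t).
have <- : D 1 = 0 by rewrite /D phi_end mulr0 pr_above_ge1 subrr.
apply: (@le_of_telescoping _ D (fun x => - (c * phi x))) => // x y tx xy y1.
have x0 := le_trans t0 tx.
have /andP[_ hi] := phi_increment x0 xy y1.
have /andP[lo _] := pr_above_increment n v x0 xy y1.
have : (y - x) * (c * phi y) <= (y - x) * pr (reach_event n v y).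
  by rewrite ler_wpM2l ?subr_ge0// bnd// y1 (le_trans x0).
rewrite /D; set A := c / mc * _ in hi *; set B := c / mc * _ in hi *.
set h := pr _ in lo *; set h' := pr _ in lo *; lra.
Qed.

End comparison.

Section branching.
Context (n : nat) (v : seq nat) (x : R).
Let C i := above_reach n (rcons v i) (x - theta).
Let missed k := \bigcap_(i in `I_k) ~` C i.
Let E := reach_event n.+1 v x.
Let children k : set (seq nat + seq nat) :=
  \bigcup_(i in `I_k) subtree (rcons v i).

Let C_blk i : blk (subtree (rcons v i)) (C i).
Proof. exact: blk_above. Qed.

Let C_measurable i : measurable (C i).
Proof. exact: above_measurable. Qed.

Let missedS k : missed k.+1 = missed k `&` ~` C k.
Proof.
by rewrite /missed IIS bigcap_setU bigcap_set1.
Qed.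

Let missed_blk k : blk (children k) (missed k).
Proof.
elim: k => [|k IH].
  by rewrite /missed II0 bigcap_set0; exact: blockT.
rewrite missedS; apply: blockI.
  apply: block_sub IH => j [i ik ji]; exists i => //.
  exact: ltn_trans ik _.
by apply: blockC; apply: block_sub (@C_blk k) => j jk; exists k => /=.
Qed.

Let missed_measurable k : measurable (missed k).
Proof. by apply: (@blk_measurable (children k)); exact: missed_blk. Qed.

Let disjoint_children k i : (k <= i)%N -> children k `&` subtree (rcons v i) = set0.
Proof.
have inj j w : prefix (rcons v i) w -> prefix (rcons v j) w -> i = j.
  move=> /prefixP[s ->] /prefixP[t]; rewrite !cat_rcons => /eqP.
  by rewrite eqseq_cat// eqxx /= => /eqP[].
move=> ki; apply/seteqP; split => // -[w|w] [[j /= jk jw] iw];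
  by move: jk; rewrite -(inj _ _ iw jw) ltnNge ki.
Qed.

Let pr_missed k : pr (missed k) = \prod_(i < k) (1 - pr (C i)).
Proof.
elim: k => [|k IH].
  by rewrite /missed II0 bigcap_set0 big_ord0 /pr probability_setT.
rewrite big_ord_recr/= -IH missedS.
have prC : pr (~` C k) = 1 - pr (C k).
  by rewrite -setTD prD// /pr probability_setT.
rewrite -prC; apply: (@pr_independent (children k) (subtree (rcons v k))).
- exact: disjoint_children.
- exact: missed_blk.
- by apply: blockC; exact: C_blk.
Qed.

Let offspring_measurable k : measurable (N v @^-1` [set k]).
Proof. by rewrite -[X in measurable X]setTI; exact: measurable_funP. Qed.

Let E_measurable : measurable E.
Proof. exact: reach_measurable. Qed.

(** The event fails, given [k] children, when each of the [k] subtrees misses;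
the number of children and the subtrees are independent. *)
Let pr_offspring_reach k :
  P (N v @^-1` [set k] `&` E) =
  ((1 - \prod_(i < k) (1 - pr (C i)))%:E * L [set k])%E.
Proof.
have LN : L [set k] = (pr (N v @^-1` [set k]))%:E.
  by rewrite -prE// -(gw_rmf_offspring model v).
rewrite prE; last exact: measurableI.
rewrite LN -EFinM; congr EFin.
have -> : N v @^-1` [set k] `&` E =
    N v @^-1` [set k] `\` (N v @^-1` [set k] `&` missed k).
  rewrite /E reach_eventS; apply/seteqP; split => w.
    move=> [Nk [i _ [iN Ci]]]; split => // -[_ miss].
    by apply: (miss i) => //; rewrite /= -Nk.
  move=> [Nk hit]; split => //; apply: contrapT => noC; apply: hit; split => // i ik Ci.
  by apply: noC; exists i => //; split => //; rewrite /= Nk.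
rewrite prD//; last exact: measurableI.
rewrite (@pr_independent [set inl v] (children k)).
- by rewrite pr_missed; ring.
- apply/seteqP; split => // j [->] [i _ /=] /prefixP[s] /(congr1 size)/eqP.
  by rewrite size_cat size_rcons -[X in X == _]addn0 addSnnS eqn_add2l.
- exact: blk_N.
- exact: missed_blk.
Qed.

Let pr_reach_series : (pr E)%:E =
  (\sum_(k <oo) (1 - \prod_(i < k) (1 - pr (C i)))%:E * L [set k])%E.
Proof.
rewrite -prE//.
have {1}-> : E = \bigcup_k (N v @^-1` [set k] `&` E).
  by apply/seteqP; split => [w Ew|w [k _ []]//]; exists (N v w).
have mNE k : measurable (N v @^-1` [set k] `&` E) by exact: measurableI.
rewrite measure_semi_bigcup//; last 2 first.
- by apply: trivIset_setIr; exact: trivIset_preimage1.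
- exact: bigcupT_measurable.
by apply: eq_eseriesr => k _; exact: pr_offspring_reach.
Qed.

Let mean_series p : 0 <= p <= 1 -> (mean_hit_prob L p)%:E =
  (\sum_(k <oo) (hit_prob k p)%:E * L [set k])%E.
Proof.
move=> p01; rewrite -mean_hit_probE// integral_nat_series// => k.
by rewrite lee_fin hit_prob_ge0.
Qed.

(** The probability that some child is hit increases with the hitting
probability of each child. *)
Lemma pr_reach_le p : 0 <= p <= 1 ->
  (forall i, pr (C i) <= p) -> pr E <= mean_hit_prob L p.
Proof.
move=> p01 Cp; have /andP[p0 p1] := p01.
rewrite -lee_fin mean_series// pr_reach_series.
apply: lee_nneseries => k _; last first.
  rewrite lee_wpmul2r// lee_fin /hit_prob lerD2l lerN2.
  rewrite -[X in (_ ^+ X)](card_ord k) -prodr_const; apply: ler_prod => i _.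
  by rewrite subr_ge0 p1 lerD2l lerN2 Cp.
by move=> _; rewrite mule_ge0// lee_fin subr_ge0 -pr_missed pr_le1.
Qed.

Lemma pr_reach_ge p : 0 <= p <= 1 ->
  (forall i, p <= pr (C i)) -> mean_hit_prob L p <= pr E.
Proof.
move=> p01 Cp; rewrite -lee_fin mean_series// pr_reach_series.
apply: lee_nneseries => k _; last first.
  rewrite lee_wpmul2r// lee_fin /hit_prob lerD2l lerN2.
  rewrite -[X in (_ ^+ X)](card_ord k) -prodr_const; apply: ler_prod => i _.
  by rewrite subr_ge0 pr_le1// lerD2l lerN2 Cp.
by move=> _; rewrite mule_ge0// lee_fin hit_prob_ge0.
Qed.

End branching.

Let perc := rmf_percolation theta N U.

Let root_reach n : set Omega :=
  [set w | reach theta (fun v => N v w) (fun v => U v w) n [::] (U [::] w)].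

Lemma percolation_bigcap : perc = \bigcap_n root_reach n.
Proof.
apply/seteqP; split => w.
  by move=> /percolates_reach r n _; exact: r.
by move=> r; apply: reach_percolates => n; exact: r.
Qed.

(** The label of the root being finite, it lies above some [- k%:R]. *)
Let root_measurable n : measurable (root_reach n).
Proof.
have -> : root_reach n = \bigcup_k above_reach n [::] (- k%:R).
  apply/seteqP; split => [w r|w [k _ []]//].
  exists (Num.truncn `|U [::] w|).+1 => //; split => //.
  by rewrite ltrNl (le_lt_trans _ (truncnS_gt _))// -normrN ler_norm.
exact: bigcupT_measurable.
Qed.

Lemma percolation_measurable : measurable perc.
Proof. by rewrite percolation_bigcap; exact: bigcapT_measurable. Qed.

(** Percolation makes the root good to any depth, and its label is positive almost
surely. *)
Lemma pr_percolation_le n : pr perc <= pr (above_reach n [::] 0).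
Proof.
have mperc := percolation_measurable; set B := above_reach _ _ _.
have mB : measurable B by exact: above_measurable.
have mU : measurable (perc `|` B) by exact: measurableU.
apply: (@le_trans _ _ (pr (perc `|` B))); first by apply: le_pr => // w pw; left.
rewrite -subr_le0 -prD; [|by []..|exact: subsetUr].
rewrite -[leRHS](pr_U_outside [::]) le_pr//.
- exact: measurableD.
- exact/measurableC/U_measurable.
move=> w [[|//]]; rewrite percolation_bigcap => r nB; rewrite /= in_itv/= => /andP[U0 _].
by apply: nB; split => //; exact: r.
Qed.

(** Continuity from above along the depths. *)
Lemma pr_percolation_ge (e : R) :
  (forall n, e <= pr (above_reach n [::] 0)) -> e <= pr perc.
Proof.
move=> eB; pose B n := above_reach n [::] 0.
have mB n : measurable (B n) by exact: above_measurable.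
have mIB : measurable (\bigcap_n B n) by exact: bigcapT_measurable.
have mperc := percolation_measurable.
apply: (@le_trans _ _ (pr (\bigcap_n B n))); last first.
  apply: le_pr => //; rewrite percolation_bigcap => w Bw n _.
  by have [] := Bw n I.
rewrite -lee_fin -prE//.
have cvgB : P (B n) @[n --> \oo] --> P (\bigcap_n B n).
  apply: nonincreasing_cvg_mu => //.
    by rewrite ltey_eq fin_num_measure.
  move=> a b ab; apply/subsetPset => w [U0 r]; split => //.
  exact: reach_le r.
rewrite -(cvg_lim _ cvgB)//; apply: lime_ge.
  by apply/cvg_ex; exists (P (\bigcap_n B n)).
by near=> n; rewrite prE// lee_fin; exact: eB.
Unshelve. all: by end_near. Qed.

End model.

Section extinction_sequence.
Context (R : realType) (L : probability nat R) (m mc : R).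
Hypotheses (mean_L : ('E_L[fun k : nat => k%:R] = m%:E)%E).
Hypotheses (mc1 : 1 <= mc) (m_mc : m <= mc).
Hypothesis nondeg : 1 < mc \/ L [set 1%N] <> 1%E.

Let mc0 : 0 < mc. Proof. exact: lt_le_trans mc1. Qed.

(** After normalization by [phi 1], the multiples of [phi] that dominate the
probabilities of goodness to depth [n] when [m <= mc]. *)
Definition extinction_seq n : R := iter n (fun s => mean_hit_prob L (s / mc)) 1.

Lemma extinction_seq01 n : 0 <= extinction_seq n <= 1.
Proof.
elim: n => [|n /andP[s0 s1]]; first by rewrite /= ler01 lexx.
have q01 : 0 <= extinction_seq n / mc <= 1.
  by rewrite divr_ge0 ?(ltW mc0)//= ler_pdivrMr// mul1r (le_trans s1).
rewrite /= mean_hit_prob_ge0//= (le_trans (mean_hit_prob_le mean_L q01))//.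
apply: (@le_trans _ _ (extinction_seq n)) => //.
by rewrite mulrCA ler_piMr// ler_pdivrMr// mul1r.
Qed.

(** As long as the sequence stays above [e], each step multiplies it by at most
the ratio [r < 1] found at [e], because [mean_hit_prob p / p] is
nonincreasing. *)
Lemma extinction_seq_small (e : R) : 0 < e -> exists n, extinction_seq n < e.
Proof.
move=> e0; wlog e1 : e e0 / e <= 1.
  move=> H; have e10 : 0 < Num.min e 1 by rewrite lt_min e0 ltr01.
  have e11 : Num.min e 1 <= 1 by rewrite ge_min lexx orbT.
  have [n] := H _ e10 e11.
  by rewrite lt_min => /andP[ne _]; exists n.
apply: contrapT => /forallNP big.
have {}big n : e <= extinction_seq n by rewrite leNgt; apply/negP/big.
pose q := e / mc; pose r := mean_hit_prob L q / e.
have q01 : 0 < q <= 1 by rewrite divr_gt0//= ler_pdivrMr// mul1r (le_trans e1).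
have r0 : 0 <= r.
  by rewrite divr_ge0 ?(ltW e0)// mean_hit_prob_ge0//; case/andP: q01 => /ltW -> ->.
have r1 : r < 1.
  rewrite ltr_pdivrMr// mul1r.
  have := mean_hit_prob_lt mean_L m_mc mc1 nondeg q01.
  by rewrite /q mulrCA divff ?mulr1// gt_eqF.
have geo n : extinction_seq n <= r ^+ n.
  elim: n => [|n IH]; first by rewrite expr0.
  have /andP[s0 s1] := extinction_seq01 n.
  have q0 : 0 <= q by case/andP: q01 => /ltW.
  have qs : q <= extinction_seq n / mc by rewrite ler_pM2r ?invr_gt0.
  have s_mc1 : extinction_seq n / mc <= 1 by rewrite ler_pdivrMr// mul1r (le_trans s1).
  have := mean_hit_prob_ratio L q0 qs s_mc1.
  rewrite /q !mulrA ler_pM2r ?invr_gt0// -ler_pdivlMr// => h.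
  apply: (le_trans h); rewrite -/q mulrAC exprS ler_wpM2l//.
have : r ^+ n @[n --> \oo] --> (0 : R) by apply: cvg_expr; rewrite ger0_norm.
move=> /cvgr_lt /(_ e e0)[n _ /(_ n (leqnn n)) /= rn].
by have := le_lt_trans (le_trans (big n) (geo n)) rn; rewrite ltxx.
Qed.

End extinction_sequence.

(** * The phase transition *)

Section phase_transition.
Context d (Omega : measurableType d) (R : realType) (P : probability Omega R).
Context (theta : R) (L : probability nat R) (m : R).
Context (N : seq nat -> {RV P >-> nat}) (U : seq nat -> {RV P >-> R}).
Hypothesis model : gw_rmf L N U.
Hypothesis mean_L : ('E_L[fun k : nat => k%:R] = m%:E)%E.
Hypothesis theta_gt0 : 0 < theta.
Context (mc : R) (phi : R -> R).
Hypothesis eig : eigenfunction theta mc phi.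

Let mc_gt0 : 0 < mc := eigen_mc_gt0 eig.
Let mc_ge1 : 1 <= mc := eigenfunction_mc_ge1 theta_gt0 eig.
Let phi1_gt0 : 0 < phi 1 := eigenfunction_gt0 theta_gt0 eig.

Let phi_ge1 (x : R) : x <= 1 -> phi 1 <= phi x.
Proof. by move=> x1; apply: (eigen_nonincreasing eig) => //; rewrite lerDl ltW. Qed.

(** By [pr_above_le] a child is hit with probability at most a multiple of
[phi x].  The point [x = 1], where this bound is smallest, has the largest
ratio [mean_hit_prob p / p], so the ratio found there can be used at all [x]. *)
Lemma pr_reach_le_extinction_seq n v (x : R) : m <= mc -> 0 <= x <= 1 ->
  pr P (reach_event theta N U n v x) <=
  extinction_seq L mc n / phi 1 * phi x.
Proof.
move=> m_mc; elim: n v x => [|n IH] v x /andP[x0 x1].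
  have -> : reach_event theta N U 0 v x = setT by exact/seteqP.
  by rewrite /pr probability_setT/= mul1r ler_pdivlMl// mulr1 phi_ge1.
have /andP[s0 s1] := extinction_seq01 mean_L mc_ge1 m_mc n.
set s := extinction_seq L mc n in IH s0 s1.
have c0 : 0 <= s / phi 1 by rewrite divr_ge0// ltW.
have px : 0 < phi x by exact: lt_le_trans (phi_ge1 x1).
set a := s / phi 1 / mc * phi x.
have a0 : 0 <= a by rewrite !mulr_ge0// ?invr_ge0 ltW.
(* [a] may exceed 1, where [mean_hit_prob] is no longer a probability. *)
pose w := Num.min 1 a.
have w01 : 0 <= w <= 1 by rewrite le_min ler01 a0 ge_min lexx.
pose q := s / mc.
have q0 : 0 <= q by rewrite divr_ge0// ltW.
have qw : q <= w.
  rewrite le_min ler_pdivrMr// mul1r (le_trans s1)//= /a /q.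
  have -> : s / phi 1 / mc * phi x = s / mc * (phi x / phi 1) by rewrite mulrAC; ring.
  by rewrite ler_peMr// ler_pdivlMr// mul1r phi_ge1.
apply: (@le_trans _ _ (mean_hit_prob L w)).
  apply: (pr_reach_le model) => // i; rewrite le_min; apply/andP; split.
    by apply: pr_le1; exact: measurable_above_reach.
  rewrite /a -{2}[x](subrK theta).
  apply: (pr_above_le model eig c0) => [|y]; last exact: IH.
  by rewrite (le_trans _ x1)// gerBl ltW.
rewrite [extinction_seq _ _ _]/= -/s -/q.
have [sp|sn] := ltP 0 s; last first.
  have a_eq0 : a = 0.
    by rewrite /a (_ : s = 0) ?mul0r//; apply/eqP; rewrite eq_le sn.
  have w0 : w = 0 by rewrite /w a_eq0; apply/min_idPr.
  rewrite w0 (le_trans (mean_hit_prob_le mean_L _)) ?lexx ?ler01// mulr0.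
  rewrite mulr_ge0 ?(ltW px)// divr_ge0 ?(ltW phi1_gt0)// mean_hit_prob_ge0//.
  by rewrite q0 (le_trans qw)//; case/andP: w01.
have qp : 0 < q by rewrite divr_gt0.
have [_ w1] := andP w01.
have := mean_hit_prob_ratio L q0 qw w1.
rewrite -ler_pdivlMr// => /le_trans; apply.
have G0 : 0 <= mean_hit_prob L q by rewrite mean_hit_prob_ge0// q0 (le_trans qw).
apply: (@le_trans _ _ (mean_hit_prob L q * a / q)).
  rewrite ler_pM2r ?invr_gt0// ler_wpM2l// /w.
  by rewrite ge_min lexx orbT.
rewrite le_eqVlt; apply/orP; left; apply/eqP; rewrite /a /q; field.
by rewrite !gt_eqF.
Qed.

Lemma subcritical_percolation : m <= mc ->
  1 < mc \/ L [set 1%N] <> 1%E -> pr P (rmf_percolation theta N U) = 0.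
Proof.
move=> m_mc nondeg; apply/eqP; rewrite eq_le pr_ge0 andbT.
apply/ler_addgt0Pr => e e0; rewrite add0r.
have [|n sn] := extinction_seq_small mean_L mc_ge1 m_mc nondeg (e := e * phi 1 * mc).
  by rewrite !mulr_gt0.
apply: le_trans (pr_percolation_le theta model n) _.
have [s0 _] := andP (extinction_seq01 mean_L mc_ge1 m_mc n).
have c0 : 0 <= extinction_seq L mc n / phi 1 by rewrite divr_ge0// ltW.
apply: le_trans (pr_above_le model eig c0 ler01 _) _.
  by move=> x; exact: pr_reach_le_extinction_seq m_mc.
rewrite add0r (eigen_eq1 eig (lexx theta)) mulr1 !ler_pdivrMr//.
by rewrite mulrAC ltW.
Qed.

(** The multiple [p * phi] is preserved from one depth to the next because
[mc * q <= mean_hit_prob q] for all [q <= p]. *)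
Lemma supercritical_percolation : mc < m -> 0 < pr P (rmf_percolation theta N U).
Proof.
move=> mc_m; have [p /andP[p0 p1] Gp] := mean_hit_prob_gt mean_L mc_m.
have le_G q : 0 < q -> q <= p -> mc * q <= mean_hit_prob L q.
  move=> q0 qp; have := mean_hit_prob_ratio L (ltW q0) qp p1.
  rewrite -ler_pdivrMr// => /(le_trans _); apply.
  by rewrite ler_pdivlMr// mulrAC ler_pM2r.
have reach_ge n v (x : R) : 0 <= x <= 1 ->
    p * phi x <= pr P (reach_event theta N U n v x).
  elim: n v x => [|n IH] v x /andP[x0 x1].
    have -> : reach_event theta N U 0 v x = setT by exact/seteqP.
    rewrite /pr probability_setT/= mulr_ile1 ?(ltW p0)//.
      by rewrite (le_trans _ (phi_ge1 x1))// ltW.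
    exact: (eigenfunction_le1 theta_gt0 eig).
  have px : 0 < phi x by exact: lt_le_trans (phi_ge1 x1).
  pose q := p / mc * phi x.
  have q0 : 0 < q by rewrite !mulr_gt0// invr_gt0.
  have qp : q <= p.
    rewrite /q -mulrA ger_pMr// mulrC ler_pdivrMr// mul1r.
    exact: le_trans (eigenfunction_le1 theta_gt0 eig x0 x1) mc_ge1.
  have q01 : 0 <= q <= 1 by rewrite (ltW q0) (le_trans qp).
  apply: (@le_trans _ _ (mean_hit_prob L q)).
    apply: le_trans (le_G q q0 qp); rewrite /q.
    by rewrite [mc * _]mulrC mulrAC divfK// gt_eqF.
  apply: (pr_reach_ge model) => // i.
  rewrite /q -{1}[x](subrK theta).
  apply: (pr_above_ge model eig (ltW p0)); last by move=> y; exact: IH.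
  by rewrite (le_trans _ x1)// gerBl ltW.
apply: (@lt_le_trans _ _ (p / mc * phi (0 + theta))).
  by rewrite add0r (eigen_eq1 eig (lexx theta)) mulr1 divr_gt0.
apply: pr_percolation_ge => n.
by apply: (pr_above_ge model eig (ltW p0) ler01) => x; exact: reach_ge.
Qed.

End phase_transition.

(* For theta = 1 and L = 1 almost surely, T is a single infinite ray along which
   the labels increase almost surely, while m = m_c(1) = 1; the hypothesis
   [theta < 1 \/ L [set 1] <> 1] removes exactly this degenerate case. *)
Theorem theorem1p2 (R : realType) (theta : R)
    (theta_gt0 : 0 < theta) (theta_le1 : theta <= 1) :
  exists2 mc : R, minimal_root (Qtheta theta) mc &
    forall (d : measure_display) (Omega : measurableType d)
      (P : probability Omega R) (L : probability nat R) (m : R)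
      (N : seq nat -> {RV P >-> nat}) (U : seq nat -> {RV P >-> R}),
      gw_rmf L N U ->
      ('E_L[fun k : nat => k%:R] = m%:E)%E ->
      ('E_L[fun k : nat => (k%:R * logp k%:R)%R] < +oo)%E ->
      (theta < 1 \/ L [set 1%N] <> 1%E) ->
      ((0 < P (rmf_percolation theta N U))%E <-> mc < m).
Proof.
have [mc mc_root [phi eig]] := exists_eigenfunction theta_gt0 theta_le1.
exists mc => // d Omega P L m N U model mean_L _ nondeg.
rewrite (prE P (percolation_measurable theta N U)) lte_fin.
split=> [perc_gt0|]; last exact: (supercritical_percolation model mean_L theta_gt0 eig).
rewrite ltNge; apply/negP => m_mc.
suff perc0 : pr P (rmf_percolation theta N U) = 0 by rewrite perc0 ltxx in perc_gt0.
apply: (subcritical_percolation model mean_L theta_gt0 eig m_mc).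
by case: nondeg => [/(eigenfunction_mc_gt1 theta_gt0 eig)|]; [left|right].
Qed.
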